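(* Let $G=H_3=[3,5]$ be the full icosahedral reflection group, let $B'$ be its fundamental domain on the unit sphere $S^2$, and let $c$ be the Chebychev center of $B'$. Then the orbit $Gc$ has $120$ elements and is an optimal approximation of $S^2$ by a finite $\mathrm{O}_3(\mathbb{R})$-homogeneous space, i.e. $d_H(Gc,S^2)\le d_H(Y,S^2)$ for every finite $\mathrm{O}_3(\mathbb{R})$-homogeneous space $Y$.
   Context: $\mathrm{O}_3(\mathbb{R})$ is the group of linear isometries of $\mathbb{R}^3$, and $S^2=\{v\in\mathbb{R}^3:\|v\|=1\}$. A finite $\mathrm{O}_3(\mathbb{R})$-homogeneous space is a set $Kx=\{kx:k\in K\}\subset\mathbb{R}^3$ with $K$ a finite subgroup of $\mathrm{O}_3(\mathbb{R})$ and $x\in\mathbb{R}^3$ (not necessarily on $S^2$). $d_H$ is the Hausdorff distance between nonempty compact subsets of $\mathbb{R}^3$ (Euclidean metric). The group $H_3=[3,5]$ is the subgroup of $\mathrm{O}_3(\mathbb{R})$ generated by the orthogonal reflections $R_1,R_2,R_3$ in the planes through the origin with unit normals $$\nu_1=(0,0,1),\quad \nu_2=\Big(\sqrt{\tfrac34-\cos^2(\pi/5)},\ \cos(\pi/5),\ \tfrac12\Big),\quad \nu_3=(0,1,0).$$ Its (closed) fundamental domain on $\mathbb{R}^3$ is the cone enclosed by these planes, $B=\{v\in\mathbb{R}^3:\langle v,\nu_1\rangle\le0,\ \langle v,\nu_2\rangle\ge0,\ \langle v,\nu_3\rangle\le0\}$, and $B'=B\cap S^2$. The Chebychev center of a nonempty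 bounded set $A\subset\mathbb{R}^3$ is the center of the unique closed ball of minimal radius containing $A$. *)

(* Defs.v *)
From mathcomp Require Import all_boot all_order all_algebra.
From mathcomp Require Import all_classical all_reals all_analysis.

Set Implicit Arguments.
Unset Strict Implicit.
Unset Printing Implicit Defensive.

Import Order.TTheory GRing.Theory Num.Theory.

Local Open Scope classical_set_scope.
Local Open Scope ring_scope.

(* MathComp-Analysis equips matrices with the sup norm; the Euclidean
   structure on R^3 (column vectors) is therefore introduced separately. *)
Definition dot (R : realType) (u v : 'cV[R]_3) : R :=
  \sum_(i < 3) u i 0 * v i 0.

Definition enorm (R : realType) (v : 'cV[R]_3) : R := Num.sqrt (dot v v).

Definition vec3 (R : realType) (a b c : R) : 'cV[R]_3 :=
  \col_(i < 3) [:: a; b; c]`_i.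

Definition unit_sphere (R : realType) : set 'cV[R]_3 := [set v | enorm v = 1].

Definition euclid_cball (R : realType) (c : 'cV[R]_3) (r : R) : set 'cV[R]_3 :=
  [set v | enorm (v - c) <= r].

(* The suprema and infima below are those of the reals, so the value is
   meaningful only for nonempty bounded sets. *)
Definition dist_to (R : realType) (B : set 'cV[R]_3) (a : 'cV[R]_3) : R :=
  inf [set enorm (a - b) | b in B].

Definition hausdorff_dist (R : realType) (A B : set 'cV[R]_3) : R :=
  Num.max (sup [set dist_to B a | a in A]) (sup [set dist_to A b | b in B]).

(* Linear isometries, given by their matrices in the standard basis. *)
Definition O3 (R : realType) : set 'M[R]_3 :=
  [set k | forall v : 'cV[R]_3, enorm (k *m v) = enorm v].

Definition O3_subgroup (R : realType) (K : set 'M[R]_3) : Prop :=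
  [/\ K `<=` @O3 R,
      K 1%:M,
      forall k l, K k -> K l -> K (k *m l) &
      forall k, K k -> K (invmx k)].

Definition orbit3 (R : realType) (K : set 'M[R]_3) (x : 'cV[R]_3) :
  set 'cV[R]_3 := [set k *m x | k in K].

Definition finite_homogeneous_space (R : realType) (Y : set 'cV[R]_3) : Prop :=
  exists (K : set 'M[R]_3) (x : 'cV[R]_3),
    [/\ O3_subgroup K, finite_set K & Y = orbit3 K x].

Definition optimal_sphere_approximation (R : realType) (X : set 'cV[R]_3) :
  Prop :=
  finite_homogeneous_space X /\
  forall Y : set 'cV[R]_3, finite_homogeneous_space Y ->
    hausdorff_dist X (@unit_sphere R) <= hausdorff_dist Y (@unit_sphere R).

(* v |-> v - 2 <nu, v> nu; this is the orthogonal reflection in the plane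
   normal to nu only when nu is a unit vector. *)
Definition reflection (R : realType) (nu : 'cV[R]_3) : 'M[R]_3 :=
  1%:M - 2 *: (nu *m nu^T).

Definition nu1 (R : realType) : 'cV[R]_3 := vec3 0 0 1.

Definition nu2 (R : realType) : 'cV[R]_3 :=
  vec3 (Num.sqrt (3 / 4 - cos (pi / 5) ^+ 2)) (cos (pi / 5)) (1 / 2).

Definition nu3 (R : realType) : 'cV[R]_3 := vec3 0 1 0.

Definition H3 (R : realType) : set 'M[R]_3 :=
  smallest (@O3_subgroup R)
    [set reflection (@nu1 R); reflection (@nu2 R); reflection (@nu3 R)].

Definition H3_cone (R : realType) : set 'cV[R]_3 :=
  [set v | [/\ dot v (@nu1 R) <= 0, 0 <= dot v (@nu2 R) &
               dot v (@nu3 R) <= 0]].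

Definition H3_domain (R : realType) : set 'cV[R]_3 :=
  @H3_cone R `&` @unit_sphere R.

Definition is_chebyshev_center (R : realType) (A : set 'cV[R]_3)
    (c : 'cV[R]_3) : Prop :=
  exists r : R, A `<=` euclid_cball c r /\
    forall (c' : 'cV[R]_3) (r' : R), A `<=` euclid_cball c' r' -> r <= r'.

(* For nonempty bounded A exactly one point satisfies is_chebyshev_center A,
   and it is the one chosen; for other A the value carries no meaning. *)
Definition chebyshev_center (R : realType) (A : set 'cV[R]_3) : 'cV[R]_3 :=
  xget 0 [set c | is_chebyshev_center A c].

(* Main.v *)
Require Import Defs.
From HB Require Import structures.
From mathcomp Require Import all_boot all_order all_algebra all_fingroup cyclic.
From mathcomp Require Import all_classical all_reals all_analysis.
From mathcomp Require Import finmap ring lra zify.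

Set Implicit Arguments.
Unset Strict Implicit.
Unset Printing Implicit Defensive.

Import Order.TTheory GRing.Theory Num.Theory.

(** The chamber B' has three corners p_i, the unit vectors on the edges of the
    cone, and they span an acute triangle. Let c be its circumcentre and put
    r^2 = 1 - |c|^2. If the l_i are the barycentric coordinates of c then

      sum_i l_i |p_i - y|^2 = r^2 + |y - c|^2   for every point y,

    so no ball of radius less than r contains the corners, and the only one of
    radius r that does is the ball about c. That ball contains all of B',
    because B' lies in the cap cut off by the plane of the corners: c is the
    Chebyshev center [chebyshev_center_H3]. Every point of the sphere is moved
    into B' by some element of the group [chamber_exists], so the orbit of c is
    at Hausdorff distance at most r from the sphere. It has 120 points since c
    is interior to the cone and so has trivial stabiliser [interior_free].

    For the lower bound, let K be a finite group of isometries such that every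
    point of the sphere is at distance less than r from the orbit K x. As
    r^2 < 1/5, K has no invariant line [invariant_line_no_cover] and no two
    orbits on the sphere that stay far apart [far_orbits_no_cover]. Let L be
    the group of the rotations that are in K up to sign. Counting the poles of
    its axes [rotation_group_poles] leaves three types. Tetrahedral and
    octahedral groups have two orbits far apart. In the icosahedral type the
    poles of order five form a regular icosahedron [icosahedral_case], so that
    K is conjugate into H3 [standard_of_orbit].

    It remains to treat a subgroup of H3 itself, where x may be moved into the
    cone. There x is at least as near to each corner as any other point of its
    H3-orbit [cone_dominant], so |p_i - x| < r for all i, which the identity
    above forbids [standard_no_cover].

    The statements about all 120 elements of H3 are finite checks in the ring
    Z[phi] of the golden ratio, carried out in the basis of the edges of the
    cone, where the generating reflections have coefficients in Z[phi]. *)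

(** * Orbit counting *)

(** With N the order of the group, this is the equation
    1/l + 1/m + 1/n = 1 + 2/N in integers l <= m <= n; orbits of one or two
    points are excluded, which removes the dihedral solutions (2, 2, n). *)
Lemma three_orbit_sizes N a b c l m n :
  a * l = N -> b * m = N -> c * n = N -> 1 < l -> 1 < m -> 1 < n ->
  2 < c -> c <= b -> b <= a -> a + b + c = N + 2 ->
  [/\ l = 2, m = 3 & [\/ c = 4 /\ n = 3, c = 6 /\ n = 4 | c = 12 /\ n = 5]].
Proof.
move=> hl hm hn l1 m1 n1 c2 cb ba hN.
have el : l = 2 by nia.
have em : m = 3 by subst l; nia.
subst l m; have hn5 : n <= 5 by nia.
have : n = 2 \/ n = 3 \/ n = 4 \/ n = 5 by lia.
by case=> [|[|[|]]] hn'; subst n; split=> //;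
  [exfalso; lia | constructor 1; lia | constructor 2; lia | constructor 3; lia].
Qed.

Section PoleOrbits.
Import GroupScope.
Local Open Scope nat_scope.
Variables (gT : finGroupType) (T : finType) (to : {action gT &-> T}).
Local Notation G := [set: gT]%G.

(** Burnside counting gives |T| + 2 (N - 1) = k N for k orbits. No orbit has
    more than N / 2 points, so k <= 3, and T has two points when k = 2. For
    k = 3 a stabiliser order greater than 3 occurs on one orbit only. *)
Lemma pole_orbits : 1 < #|gT| ->
  (forall g : gT, g != 1%g -> #|'Fix_to[g]| = 2) ->
  (forall x : T, 1 < #|'C_G[x | to]|) ->
  (exists x, #|orbit to G x| <= 2) \/
  (exists x, (#|orbit to G x| = 4 /\ #|'C_G[x | to]| = 3) \/
     ((#|orbit to G x| = 6 /\ #|'C_G[x | to]| = 4 \/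
       #|orbit to G x| = 12 /\ #|'C_G[x | to]| = 5) /\
      forall y, #|'C_G[y | to]| = #|'C_G[x | to]| -> y \in orbit to G x)).
Proof.
move=> N1 hfix hst.
have acts : [acts G, on [set: T] | to].
  by apply/fintype.subsetP => g _; rewrite !inE; apply/fintype.subsetP => x _; rewrite !inE.
pose X := orbit to G @: [set: T].
have hT : \sum_(A in X) #|A| = #|T|.
  by rewrite -cardsT; apply/esym/card_partition/orbit_partition.
have hX : #|T| + 2 * (#|gT| - 1) = #|X| * #|gT|.
  have := Frobenius_Cauchy acts; rewrite cardsT => <-.
  rewrite (bigD1 1%g) ?inE //=; congr (_ + _).
    by apply: eq_card => x; rewrite !inE finset.sub1set inE act1 eqxx.
  rewrite (eq_bigr (fun _ => 2)) => [|g /andP[_ g1]].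
    rewrite sum_nat_const [RHS]mulnC; congr (_ * _).
    rewrite -[#|gT|]cardsT (cardsD1 1%g) inE addKn.
    by apply: eq_card => g; rewrite !inE andbT unfold_in inE.
  by rewrite -(hfix g g1); apply: eq_card => x; rewrite !inE.
have horb A : A \in X -> exists x, A = orbit to G x by case/imsetP=> x _ ->; exists x.
have hcs x : #|orbit to G x| * #|'C_G[x | to]| = #|gT|.
  by rewrite card_orbit_stab cardsT.
have hA A : A \in X -> 0 < #|A| /\ 2 * #|A| <= #|gT|.
  case/horb=> x ->; have := hcs x; have := hst x; split; last by nia.
  by apply/card_gt0P; exists x; apply: orbit_refl.
case: (boolP [exists x, #|orbit to G x| <= 2]) => [/existsP|]; first by left.
rewrite negb_exists => /forallP big; right.
have {}big x : 2 < #|orbit to G x| by rewrite ltnNge.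
pose s := sort (fun A B : {set T} => #|B| <= #|A|) (enum X).
have ps : perm_eq s (enum X) by rewrite perm_sort.
have ss : sorted (fun A B : {set T} => #|B| <= #|A|) s.
  by apply: sort_sorted => A B; apply: leq_total.
have sX A : (A \in s) = (A \in X) by rewrite (perm_mem ps) mem_enum.
have hs : \sum_(A <- s) #|A| = #|T| by rewrite (perm_big _ ps) big_enum hT.
have zs : size s = #|X| by rewrite (perm_size ps) -cardE.
have hs2 : 2 * \sum_(A <- s) #|A| <= size s * #|gT|.
  rewrite big_distrr /= big_seq_cond (leq_trans (n := \sum_(A <- s | (A \in s) && true) #|gT|)) //.
    by apply: leq_sum => A; rewrite sX andbT => /hA[].
  by rewrite -big_seq_cond big_const_seq count_predT iter_addn_0 mulnC.
have := hs2; rewrite hs zs => hs2'.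
have [x _|k0] := pickP (@predT T); last first.
  have : #|T| = 0 by apply: eq_card0 => x; have := k0 x.
  have : #|X| = 0 by apply: eq_card0 => A; apply/imsetP => -[x]; have := k0 x.
  by nia.
have T3 : 2 < #|T| by apply: leq_trans (big x) (max_card _).
have X3 : #|X| = 3 by nia.
move: zs sX hs ss; rewrite X3 in hX *.
case: s {ps hs2} => [|A [|B [|C [|]]]] //= _ sX.
rewrite !big_cons big_nil /= addn0 andbT => hs /andP[BA CB].
have [[x1 eA] [x2 eB] [x3 eC]] :
    [/\ exists x, A = orbit to G x, exists x, B = orbit to G x & exists x, C = orbit to G x].
  by split; apply: horb; rewrite -sX !inE eqxx ?orbT.
have [|||e1 e2 e3] := @three_orbit_sizes _ _ _ _ _ _ _ (hcs x1) (hcs x2)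
  (hcs x3) (hst x1) (hst x2) (hst x3) (big x3).
- by rewrite -eB -eC.
- by rewrite -eB -eA.
- rewrite -eA -eB -eC -addnA hs. move: hX N1; clear; set M := #|T|; set N := #|gT|; lia.
exists x3; case: e3 => [|h3|h3]; [by left| |]; right; (split; [tauto|move=> y hy]).
all: have : orbit to G y \in X by apply: imset_f; rewrite inE.
all: have hc z : orbit to G y = orbit to G z -> #|'C_G[y | to]| = #|'C_G[z | to]|
  by move=> e; have := hcs y; have := hcs z; have := big z; rewrite e; nia.
all: rewrite -sX !inE eA eB eC => /or3P[]/eqP e; try (by rewrite -e orbit_refl).
all: by have := hc _ e; rewrite hy ?e1 ?e2 h3.2.
Qed.
End PoleOrbits.

Local Open Scope classical_set_scope.
Local Open Scope ring_scope.

(** * Euclidean geometry of three-space *)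

Section Euclid.
Variable R : realType.
Implicit Types (u v w x y : 'cV[R]_3) (a b c : R) (k l : 'M[R]_3).

Lemma dotE u v : dot u v = u 0 0 * v 0 0 + u 1 0 * v 1 0 + u 2%:R 0 * v 2%:R 0.
Proof.
rewrite /dot !big_ord_recr big_ord0 /= add0r.
by congr (_ * _ + _ * _ + _ * _); congr (_ _ _); apply/val_inj.
Qed.

Lemma vec3_eq u v : u 0 0 = v 0 0 -> u 1 0 = v 1 0 -> u 2%:R 0 = v 2%:R 0 -> u = v.
Proof.
move=> h0 h1 h2; apply/colP => -[[|[|[|//]]] hi].
- by rewrite (_ : Ordinal hi = 0) //; apply/val_inj.
- by rewrite (_ : Ordinal hi = 1) //; apply/val_inj.
- by rewrite (_ : Ordinal hi = 2%:R) //; apply/val_inj.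
Qed.

Lemma vec3K a b c :
  [/\ vec3 a b c 0 0 = a, vec3 a b c 1 0 = b & vec3 a b c 2%:R 0 = c].
Proof. by rewrite /vec3 !mxE. Qed.

Lemma dot_vec3 a b c a' b' c' :
  dot (vec3 a b c) (vec3 a' b' c') = a * a' + b * b' + c * c'.
Proof. by rewrite dotE; case: (vec3K a b c) (vec3K a' b' c') => -> -> -> [-> -> ->]. Qed.

Lemma dotC u v : dot u v = dot v u.
Proof. by rewrite !dotE; ring. Qed.

Lemma dotDl u v w : dot (u + v) w = dot u w + dot v w.
Proof. by rewrite !dotE !mxE; ring. Qed.

Lemma dotZl a u v : dot (a *: u) v = a * dot u v.
Proof. by rewrite !dotE !mxE; ring. Qed.

Lemma dotNl u v : dot (- u) v = - dot u v.
Proof. by rewrite !dotE !mxE; ring. Qed.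

Lemma dot0l u : dot 0 u = 0.
Proof. by rewrite !dotE !mxE; ring. Qed.

Lemma dotDr u v w : dot u (v + w) = dot u v + dot u w.
Proof. by rewrite dotC dotDl !(dotC u). Qed.

Lemma dotZr a u v : dot u (a *: v) = a * dot u v.
Proof. by rewrite dotC dotZl dotC. Qed.

Lemma dotNr u v : dot u (- v) = - dot u v.
Proof. by rewrite dotC dotNl dotC. Qed.

Lemma dot0r u : dot u 0 = 0.
Proof. by rewrite dotC dot0l. Qed.

Definition dot_bilin :=
  (dotDl, dotDr, dotZl, dotZr, dotNl, dotNr, dot0l, dot0r).

Lemma dot_sumr (I : Type) (s : seq I) (P : pred I) (F : I -> 'cV[R]_3) u :
  dot u (\sum_(i <- s | P i) F i) = \sum_(i <- s | P i) dot u (F i).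
Proof. exact: (big_morph (dot u) (dotDr u) (dot0r u)). Qed.

Lemma dot_ge0 u : 0 <= dot u u.
Proof. by rewrite dotE -!expr2 !addr_ge0 ?sqr_ge0. Qed.

Lemma dot_eq0 u : (dot u u == 0) = (u == 0).
Proof.
apply/eqP/eqP => [|->]; last exact: dot0l.
rewrite dotE => h.
have := sqr_ge0 (u 0 0); have := sqr_ge0 (u 1 0); have := sqr_ge0 (u 2%:R 0).
rewrite !expr2 => h2 h1 h0.
by apply: vec3_eq; rewrite mxE; apply/eqP; rewrite -[_ == 0]orbb -mulf_eq0; apply/eqP; lra.
Qed.

Lemma enorm_ge0 u : 0 <= enorm u.
Proof. exact: sqrtr_ge0. Qed.


Lemma enorm_sqr u : enorm u ^+ 2 = dot u u.
Proof. by rewrite sqr_sqrtr ?dot_ge0. Qed.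

Lemma unit_sphereP v : unit_sphere v <-> dot v v = 1.
Proof.
rewrite /unit_sphere /=; split=> [h|h]; first by rewrite -enorm_sqr h expr1n.
by rewrite /enorm h sqrtr1.
Qed.

Lemma dist_sqr u v : dot u u = 1 -> dot (u - v) (u - v) = 1 - 2 * dot u v + dot v v.
Proof. by move=> hu; rewrite !dot_bilin (dotC v u) hu; ring. Qed.

Lemma unit_dot_le1 u v : dot u u = 1 -> dot v v = 1 -> dot u v <= 1.
Proof. by move=> hu hv; have := dot_ge0 (u - v); rewrite dist_sqr // hv; lra. Qed.

(* Orthogonal matrices *)
Lemma dot_mulmx u v : dot u v = (u^T *m v) 0 0.
Proof. by rewrite mxE; apply: eq_bigr => i _; rewrite mxE. Qed.

(** Polarisation: an isometry fixing the origin preserves the inner product. *)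
Lemma dot_O3 k u v : O3 k -> dot (k *m u) (k *m v) = dot u v.
Proof.
move=> hk; have hq w : dot (k *m w) (k *m w) = dot w w by rewrite -!enorm_sqr hk.
have := hq (u + v); rewrite mulmxDr !dot_bilin !hq.
by rewrite (dotC (k *m v)) (dotC v); lra.
Qed.

Lemma O3_dot k : (forall u v, dot (k *m u) (k *m v) = dot u v) -> O3 k.
Proof. by move=> hk v; rewrite /enorm hk. Qed.

Lemma O3P k : O3 k <-> k^T *m k = 1%:M.
Proof.
split=> [hk|hk]; last first.
  by apply: O3_dot => u v; rewrite !dot_mulmx trmx_mul -mulmxA (mulmxA k^T) hk mul1mx.
apply/matrixP => i j; rewrite !mxE.
transitivity (dot (k *m delta_mx i 0) (k *m delta_mx j 0)).
  by apply: eq_bigr => m _; rewrite -!colE !mxE.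
rewrite dot_O3 // /dot (bigD1 i) //= big1 ?addr0 => [|m mi].
  by rewrite !mxE !eqxx mul1r eq_sym andbT.
by rewrite !mxE (negPf mi) mul0r.
Qed.

Lemma O3_tr k : O3 k -> O3 k^T.
Proof. by move=> /O3P/mulmx1C h; apply/O3P; rewrite trmxK. Qed.

Lemma O3_inv k : O3 k -> invmx k = k^T.
Proof.
move=> /O3P h; have [_ ku] := mulmx1_unit h.
by apply: (can_inj (mulKmx ku)); rewrite mulmxV //; apply/esym/mulmx1C.
Qed.

Lemma O3_mul k l : O3 k -> O3 l -> O3 (k *m l).
Proof. by move=> hk hl v; rewrite -mulmxA hk hl. Qed.

Lemma O3_1 : O3 (1%:M : 'M[R]_3).
Proof. by move=> v; rewrite mul1mx. Qed.

Lemma O3_opp k : O3 k -> O3 (- k).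
Proof. by move=> hk; apply: O3_dot => u v; rewrite !mulNmx !dot_bilin opprK dot_O3. Qed.

Lemma O3_det k : O3 k -> \det k = 1 \/ \det k = -1.
Proof.
move=> /O3P/(congr1 determinant); rewrite det_mulmx det_tr det1 => h.
by have /eqP: \det k ^+ 2 = 1 by []; rewrite sqrf_eq1 => /orP[]/eqP; [left|right].
Qed.

Lemma dot_adj k u v : O3 k -> dot (k *m u) v = dot u (k^T *m v).
Proof.
by move=> hk; rewrite -(dot_O3 _ _ (O3_tr hk)) mulmxA (O3P _).1 // mul1mx.
Qed.

(* a vector orthogonal to three pairwise orthogonal nonzero vectors is zero *)
End Euclid.

(** * Frames and rotations *)

Section Frames.
Variable R : realType.
Implicit Types (u v w x y p q : 'cV[R]_3) (a b c : R) (k l : 'M[R]_3).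

Definition frame u v w : 'M[R]_3 :=
  \matrix_(i, j) vec3 (u i 0) (v i 0) (w i 0) j 0.

Lemma frame_mul u v w x :
  frame u v w *m x = x 0 0 *: u + x 1 0 *: v + x 2%:R 0 *: w.
Proof.
apply/colP => i; transitivity (dot (vec3 (u i 0) (v i 0) (w i 0)) x).
  by rewrite mxE; apply: eq_bigr => j _; rewrite mxE.
by rewrite dotE !mxE /=; ring.
Qed.

Lemma mul_frame k u v w : k *m frame u v w = frame (k *m u) (k *m v) (k *m w).
Proof.
apply/matrixP => i -[[|[|[|//]]] hj]; rewrite !mxE /=;
  by apply: eq_bigr => m _; rewrite !mxE.
Qed.

Lemma tr_frame_mul u v w x :
  (frame u v w)^T *m x = vec3 (dot u x) (dot v x) (dot w x).
Proof.
apply/colP => -[[|[|[|//]]] hj]; rewrite !mxE /=;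
  by apply: eq_bigr => m _; rewrite !mxE.
Qed.

Lemma inj_unitmx k : (forall x, k *m x = 0 -> x = 0) -> k \in unitmx.
Proof.
move=> hk; rewrite -unitmx_tr -row_free_unit; apply: inj_row_free => v hv.
by apply: trmx_inj; rewrite trmx0; apply: hk; apply: trmx_inj; rewrite trmx_mul trmxK hv trmx0.
Qed.

Lemma vec3_0 a b c : vec3 a b c = 0 -> [/\ a = 0, b = 0 & c = 0].
Proof. by move=> h; case: (vec3K a b c); rewrite h !mxE. Qed.

(** A frame is a basis as soon as its Gram matrix has no kernel. *)
Lemma frame_unitmx u v w :
  (forall a b c,
     a * dot u u + b * dot u v + c * dot u w = 0 ->
     a * dot u v + b * dot v v + c * dot v w = 0 ->
     a * dot u w + b * dot v w + c * dot w w = 0 -> [/\ a = 0, b = 0 & c = 0]) ->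
  frame u v w \in unitmx.
Proof.
move=> h; apply: inj_unitmx => x; rewrite frame_mul => hx.
have hz y : dot y (x 0 0 *: u + x 1 0 *: v + x 2%:R 0 *: w) = 0 by rewrite hx dot0r.
have [] := h (x 0 0) (x 1 0) (x 2%:R 0).
- by rewrite -(hz u) !dot_bilin.
- by rewrite -(hz v) !dot_bilin (dotC v u).
- by rewrite -(hz w) !dot_bilin (dotC w u) (dotC w v).
by move=> h0 h1 h2; apply: vec3_eq; rewrite mxE.
Qed.

Lemma frame_ext u v w x y : frame u v w \in unitmx ->
  dot u x = dot u y -> dot v x = dot v y -> dot w x = dot w y -> x = y.
Proof.
rewrite -unitmx_tr => hM h0 h1 h2; apply: (can_inj (mulKmx hM)).
by rewrite !tr_frame_mul h0 h1 h2.
Qed.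

Lemma frame_mx_ext u v w k l : frame u v w \in unitmx ->
  k *m u = l *m u -> k *m v = l *m v -> k *m w = l *m w -> k = l.
Proof.
move=> hM h0 h1 h2; apply: (can_inj (mulmxK hM)).
by rewrite !mul_frame h0 h1 h2.
Qed.

Lemma orth_frame_unitmx u v w : u != 0 -> v != 0 -> w != 0 ->
  dot u v = 0 -> dot u w = 0 -> dot v w = 0 -> frame u v w \in unitmx.
Proof.
rewrite -!dot_eq0 => u0 v0 w0 h0 h1 h2; apply: frame_unitmx => a b c.
rewrite h0 h1 h2 !mulr0 !addr0 !add0r.
move=> /eqP + /eqP + /eqP; rewrite !mulf_eq0 (negPf u0) (negPf v0) (negPf w0).
by rewrite !orbF => /eqP-> /eqP-> /eqP->.
Qed.

(** Two frames with the same Gram matrix differ by an orthogonal matrix. *)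
Lemma congruent_frames u v w u' v' w' : frame u v w \in unitmx ->
  dot u' u' = dot u u -> dot v' v' = dot v v -> dot w' w' = dot w w ->
  dot u' v' = dot u v -> dot u' w' = dot u w -> dot v' w' = dot v w ->
  exists T : 'M[R]_3, [/\ O3 T, T *m u = u', T *m v = v' & T *m w = w'].
Proof.
move=> hM huu hvv hww huv huw hvw.
exists (frame u' v' w' *m invmx (frame u v w)).
have hT : frame u' v' w' *m invmx (frame u v w) *m frame u v w = frame u' v' w'.
  by rewrite -mulmxA mulVmx // mulmx1.
set T := _ *m invmx _ in hT *.
have hd a b c : T *m (a *: u + b *: v + c *: w) = a *: u' + b *: v' + c *: w'.
  have := congr1 (mulmxr (vec3 a b c)) hT; rewrite /= -mulmxA !frame_mul.
  by case: (vec3K a b c) => -> -> ->.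
split.
- apply: O3_dot => x y.
  have hx z : z = (invmx (frame u v w) *m z) 0 0 *: u + (invmx (frame u v w) *m z) 1 0 *: v
      + (invmx (frame u v w) *m z) 2%:R 0 *: w.
    by rewrite -frame_mul mulmxA mulmxV // mul1mx.
  rewrite (hx x) (hx y) !hd !dot_bilin !(dotC v' u') !(dotC w' u') !(dotC w' v').
  by rewrite huu hvv hww huv huw hvw (dotC v u) (dotC w u) (dotC w v); ring.
- by have := hd 1 0 0; rewrite !scale0r !scale1r !addr0.
- by have := hd 0 1 0; rewrite !scale0r !scale1r !addr0 !add0r.
- by have := hd 0 0 1; rewrite !scale0r !scale1r !add0r.
Qed.

Lemma unit_dot_sqr1 p q : dot p p = 1 -> dot q q = 1 -> dot p q ^+ 2 = 1 ->
  p = q \/ p = - q.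
Proof.
move=> hp hq /eqP; rewrite sqrf_eq1 => /orP[]/eqP h; [left|right].
- apply/eqP; rewrite -subr_eq0 -dot_eq0 dist_sqr // h hq; apply/eqP; ring.
- apply/eqP; rewrite -subr_eq0 -dot_eq0 dist_sqr // !dot_bilin h hq; apply/eqP; ring.
Qed.

Definition cross u v : 'cV[R]_3 :=
  vec3 (u 1 0 * v 2%:R 0 - u 2%:R 0 * v 1 0)
       (u 2%:R 0 * v 0 0 - u 0 0 * v 2%:R 0)
       (u 0 0 * v 1 0 - u 1 0 * v 0 0).

Lemma dot_crossl u v : dot u (cross u v) = 0.
Proof. by rewrite dotE !mxE /=; ring. Qed.

Lemma dot_crossr u v : dot v (cross u v) = 0.
Proof. by rewrite dotE !mxE /=; ring. Qed.

Lemma cross_sqr u v :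
  dot (cross u v) (cross u v) = dot u u * dot v v - dot u v ^+ 2.
Proof. by rewrite /cross dot_vec3 !dotE; ring. Qed.

(** A proper rotation fixing two independent directions fixes a frame: the
    image of their cross product is plus or minus that product, and the
    determinant decides the sign. *)
Lemma rotation_fix2 l p q : O3 l -> \det l = 1 -> dot p p = 1 -> dot q q = 1 ->
  l *m p = p -> l *m q = q -> p <> q -> p <> - q -> l = 1%:M.
Proof.
move=> hl dl hp hq lp lq pq pNq; set n := cross p q.
have hnn : dot n n = 1 - dot p q ^+ 2 by rewrite cross_sqr hp hq mulr1.
have n0 : dot n n != 0.
  rewrite hnn; apply/eqP => /subr0_eq/esym; by case/unit_dot_sqr1.
have pn : dot p n = 0 by apply: dot_crossl.
have qn : dot q n = 0 by apply: dot_crossr.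
have hM : frame p q n \in unitmx.
  apply: frame_unitmx => a b c; rewrite pn qn hp hq !mulr0 !addr0 !mulr1 add0r.
  move=> ha hb /eqP; rewrite mulf_eq0 (negPf n0) orbF => /eqP->.
  have b0 : b = 0.
    have /eqP : b * dot n n = 0.
      rewrite hnn; transitivity (a * dot p q + b - dot p q * (a + b * dot p q)); first ring.
      by rewrite ha hb; ring.
    by rewrite mulf_eq0 (negPf n0) orbF => /eqP.
  by split => //; move: ha; rewrite b0 mul0r addr0.
pose a := dot (l *m n) n / dot n n.
have ln : l *m n = a *: n.
  apply: (frame_ext hM); rewrite dotZr.
  - by rewrite -{1}lp dot_O3 // pn mulr0.
  - by rewrite -{1}lq dot_O3 // qn mulr0.
  - by rewrite /a divfK // dotC.
have da : a = 1.
  have : l *m frame p q n = frame p q n *m frame (vec3 1 0 0) (vec3 0 1 0) (vec3 0 0 a).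
    rewrite !mul_frame lp lq ln !frame_mul.
    by rewrite !mxE /= !scale0r !scale1r !addr0 !add0r.
  move=> /(congr1 determinant); rewrite !det_mulmx dl mul1r => h.
  have hd : \det (frame p q n) != 0 by rewrite -unitfE -unitmxE.
  have -> : a = \det (frame (vec3 1 0 0) (vec3 0 1 0) (vec3 0 0 a)).
    transitivity (\det (diag_mx (vec3 1 1 a)^T)).
      by rewrite det_diag !big_ord_recr big_ord0 /= !mxE /= !mul1r.
    congr (\det _); apply/matrixP => -[[|[|[|//]]] ?] -[[|[|[|//]]] ?]; by rewrite !mxE.
  by apply: (mulfI hd); rewrite mulr1 -h.
by apply: (frame_mx_ext hM); rewrite mul1mx // ln da scale1r.
Qed.

Lemma unit_normalize x : x != 0 -> dot ((enorm x)^-1 *: x) ((enorm x)^-1 *: x) = 1.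
Proof.
rewrite -dot_eq0 => x0; rewrite !dot_bilin -enorm_sqr in x0 *.
by move: x0; rewrite sqrf_eq0 => x0; field.
Qed.

(** In odd dimension, det (l - 1) = det (l - l l^T) = - det (l - 1). *)
Lemma rotation_axis l : O3 l -> \det l = 1 ->
  exists2 p, dot p p = 1 & l *m p = p.
Proof.
move=> hl dl; have : \det (l^T - 1%:M) == 0.
  have : \det (l^T - 1%:M) = - \det (l^T - 1%:M).
    have -> : - \det (l^T - 1%:M) = \det (1%:M - l^T).
      by rewrite -[X in _ = \det X]opprB -(scaleN1r (l^T - 1%:M)) detZ -signr_odd /= expr1 mulN1r.
    have -> : 1%:M - l^T = l^T *m (l - 1%:M).
      by rewrite mulmxBr mulmx1 (O3P _).1.
    by rewrite det_mulmx det_tr dl mul1r -det_tr linearB /= trmx1.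
  by move=> h; apply/eqP; lra.
move=> /det0P[v v0]; rewrite mulmxBr mulmx1 => /subr0_eq hv.
have x0 : v^T != 0 by rewrite -(trmx0 _ 1 3) (inj_eq trmx_inj).
have lx : l *m v^T = v^T by apply: trmx_inj; rewrite trmx_mul trmxK.
by exists ((enorm v^T)^-1 *: v^T); rewrite ?unit_normalize // -scalemxAr lx.
Qed.

End Frames.

(** * Poles of a finite rotation group *)

Section Poles.
Variables (R : realType) (gT : finGroupType) (rho : gT -> 'M[R]_3).
Hypotheses (rho1 : rho 1%g = 1%:M) (rhoM : {morph rho : g h / (g * h)%g >-> g *m h}).
Hypotheses (rhoO : forall g, O3 (rho g)) (rhoD : forall g, \det (rho g) = 1).
Hypothesis (rhoI : injective rho).
Implicit Types (p q u v w : 'cV[R]_3) (g h : gT).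

Definition orb p : seq 'cV[R]_3 := undup [seq rho g *m p | g <- enum gT].
Definition stab p : {set gT} := [set g | rho g *m p == p].

Lemma orbP p v : reflect (exists g, v = rho g *m p) (v \in orb p).
Proof.
rewrite mem_undup; apply: (iffP mapP) => [[g _ ->]|[g ->]]; exists g => //.
by rewrite mem_enum.
Qed.

Lemma rhoVK g : cancel (mulmx (rho g)) (mulmx (rho g^-1%g) : 'cV[R]_3 -> 'cV_3).
Proof. by move=> v; rewrite mulmxA -rhoM mulVg rho1 mul1mx. Qed.

Lemma rhoKV g : cancel (mulmx (rho g^-1%g)) (mulmx (rho g) : 'cV[R]_3 -> 'cV_3).
Proof. by move=> v; rewrite mulmxA -rhoM mulgV rho1 mul1mx. Qed.

Lemma dot_rho g v w : dot (rho g *m v) (rho g *m w) = dot v w.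
Proof. exact: dot_O3. Qed.

Lemma orb_refl p : p \in orb p.
Proof. by apply/orbP; exists 1%g; rewrite rho1 mul1mx. Qed.

Lemma orb_act g p v : v \in orb p -> rho g *m v \in orb p.
Proof. by case/orbP=> h ->; apply/orbP; exists (g * h)%g; rewrite rhoM mulmxA. Qed.

Lemma orb_unit p v : dot p p = 1 -> v \in orb p -> dot v v = 1.
Proof. by move=> hp /orbP[g ->]; rewrite dot_rho. Qed.

Lemma orb_opp p v : - p \in orb p -> v \in orb p -> - v \in orb p.
Proof. by move=> hp /orbP[g ->]; rewrite -mulmxN orb_act. Qed.

(** Apart from the two poles of its axis, a nontrivial rotation fixes no
    unit vector. *)
Lemma stab_semiregular p v g h : dot p p = 1 -> dot v v = 1 -> v <> p -> v <> - p ->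
  g \in stab p -> h \in stab p -> rho g *m v = rho h *m v -> g = h.
Proof.
rewrite !inE => hp hv vp vNp /eqP gp /eqP hhp gv.
have fix1 u : rho g *m u = rho h *m u -> rho (h^-1 * g)%g *m u = u.
  by rewrite rhoM -mulmxA => ->; rewrite rhoVK.
have : rho (h^-1 * g)%g = 1%:M.
  apply: (@rotation_fix2 _ _ p v) => //; first by apply: fix1; rewrite gp hhp.
  - exact: fix1.
  - by move=> e; apply: vp.
  - by move=> e; apply: vNp; rewrite e opprK.
by rewrite -rho1 => /rhoI/eqP; rewrite -eq_mulVg1 => /eqP.
Qed.

Lemma fixed_pole g : g != 1%g ->
  exists p, dot p p = 1 /\ forall v, (dot v v = 1 /\ rho g *m v = v) <-> (v = p \/ v = - p).
Proof.
move=> g1; have [p hp gp] := rotation_axis (rhoO g) (rhoD g).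
exists p; split=> // v; split=> [[hv gv]|[]->]; last 2 first.
- by [].
- by rewrite !dot_bilin opprK mulmxN gp.
have [->|vp] := pselect (v = p); first by left.
have [->|vNp] := pselect (v = - p); first by right.
case/eqP: g1; apply: (@stab_semiregular p v) => //; rewrite ?inE ?gp ?rho1 ?mul1mx //.
Qed.

(** The choice of one of the two poles is immaterial; the value at the identity
    is a default. *)
Definition axis g : 'cV[R]_3 :=
  if pselect (g != 1%g) is left g1 then sval (cid (fixed_pole g1)) else 0.

Lemma axisP g : g != 1%g -> dot (axis g) (axis g) = 1 /\
  forall v, (dot v v = 1 /\ rho g *m v = v) <-> (v = axis g \/ v = - axis g).
Proof. by move=> g1; rewrite /axis; case: pselect => // g1'; case: cid. Qed.

Definition poles : seq 'cV[R]_3 :=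
  flatten [seq [:: axis g; - axis g] | g <- enum gT & g != 1%g].

Lemma polesP v : (v \in poles) <-> (dot v v = 1 /\ exists2 g, g != 1%g & rho g *m v = v).
Proof.
split=> [/flattenP[s /mapP[g]]|[hv [g g1 gv]]].
  rewrite mem_filter => /andP[g1 _] -> hv; have [_ /(_ v)[_ h]] := axisP g1.
  have [|hv1 gv] := h; last by split => //; exists g.
  by move: hv; rewrite !inE => /orP[]/eqP; [left|right].
apply/flattenP; exists [:: axis g; - axis g].
  by apply/mapP; exists g => //; rewrite mem_filter g1 mem_enum.
have [_ /(_ v)[h _]] := axisP g1.
by rewrite !inE; case: h => // ->; rewrite eqxx ?orbT.
Qed.

Lemma poles_act g v : v \in poles -> rho g *m v \in poles.
Proof.
move=> /polesP[hv [h h1 hhv]]; apply/polesP; split; first by rewrite dot_rho.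
exists (g * h * g^-1)%g.
  by rewrite -eq_mulgV1; apply: contra h1 => /eqP/(canRL (mulKg g)) ->; rewrite mulVg.
by rewrite !rhoM -!mulmxA rhoVK hhv.
Qed.

(** The inverse turns left multiplication into a right action. *)
Definition pole_act (x : seq_sub poles) g : seq_sub poles :=
  SeqSub (poles_act g^-1%g (ssvalP x)).

Lemma pole_act1 : pole_act^~ 1%g =1 id.
Proof. by move=> x; apply: val_inj; rewrite /= invg1 rho1 mul1mx. Qed.

Lemma pole_actM : forall x, act_morph pole_act x.
Proof. by move=> x g h; apply: val_inj; rewrite /= invMg rhoM mulmxA. Qed.

Canonical pole_action := TotalAction pole_act1 pole_actM.

Lemma rho_fixV g v : (rho g^-1%g *m v == v) = (rho g *m v == v).
Proof.
by apply/eqP/eqP => h; [rewrite -{1}h rhoKV | rewrite -{1}h rhoVK].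
Qed.

Lemma size_orb (x : seq_sub poles) :
  size (orb (val x)) = #|orbit pole_action [set: gT]%SET x|.
Proof.
rewrite cardE -[RHS](size_map val); apply/perm_size/uniq_perm.
- exact: undup_uniq.
- by rewrite map_inj_uniq ?enum_uniq //; apply: val_inj.
move=> v; apply/orbP/mapP => [[g ->]|[y]].
  exists (pole_act x g^-1%g); last by rewrite /= invgK.
  by rewrite mem_enum; apply: mem_orbit; rewrite inE.
by rewrite mem_enum => /orbitP[g _ <-] ->; exists g^-1%g.
Qed.

Lemma card_stab (x : seq_sub poles) :
  #|stab (val x)| = #|'C_([set: gT]%SET)[x | pole_action]%g|.
Proof.
apply: eq_card => g; rewrite !inE /= finset.sub1set inE /= -rho_fixV.
by rewrite -(inj_eq val_inj).
Qed.

(** Each nontrivial rotation has two poles and each pole has a nontrivial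
    stabiliser, so orbit counting applies to the set of poles. A pole and its
    antipode have the same stabiliser; when the order of the latter determines
    the orbit, the orbit is closed under the antipodal map. *)
Lemma rotation_group_poles : exists p, dot p p = 1 /\
  [\/ (size (orb p) <= 2)%N, size (orb p) = 4 /\ #|stab p| = 3,
      [/\ size (orb p) = 6, #|stab p| = 4 & - p \in orb p] |
      [/\ size (orb p) = 12, #|stab p| = 5 & - p \in orb p]].
Proof.
have [N1|N1] := leqP #|gT| 1.
  exists (vec3 1 0 0); split; first by rewrite dot_vec3; ring.
  constructor 1; rewrite (leq_trans (size_undup _)) // size_map -cardE.
  exact: leq_trans N1 _.
have unitx (x : seq_sub poles) : dot (val x) (val x) = 1.
  by have /polesP[] := ssvalP x.
have hfix g : g != 1%g -> #|'Fix_pole_action[g]%g| = 2.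
  move=> g1; have [hp hv] := axisP g1.
  have mp v : v = axis g \/ v = - axis g -> v \in poles.
    by move=> /hv[h1 h2]; apply/polesP; split=> //; exists g.
  have -> : 'Fix_pole_action[g]%g = [set SeqSub (mp _ (or_introl (erefl _)));
      SeqSub (mp _ (or_intror (erefl _)))]%SET.
    apply/setP => x; rewrite inE finset.sub1set inE [in RHS]inE !inE.
    rewrite -!(inj_eq (val_inj : injective (@ssval _ poles))) /= rho_fixV.
    apply/eqP/orP => [gx|hx].
      by have [] := (hv (val x)).1 (conj (unitx x) gx) => ->; rewrite eqxx; [left|right].
    by apply: ((hv (val x)).2 _).2; case: hx => /eqP; [left|right].
  rewrite cards2 -(inj_eq (val_inj : injective (@ssval _ poles))) /=.
  suff -> : axis g != - axis g by [].
  apply/eqP => h; have : dot (axis g) (axis g) = - dot (axis g) (axis g).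
    by rewrite {1}h !dot_bilin.
  by rewrite hp; lra.
have hst (x : seq_sub poles) : (1 < #|'C_([set: gT]%SET)[x | pole_action]%g|)%N.
  rewrite -card_stab; have /polesP[_ [g g1 gx]] := ssvalP x.
  rewrite (cardsD1 1%g) (cardsD1 g) !inE rho1 mul1mx eqxx g1 /=.
  by move/eqP: gx => ->.
have [[x hx]|[x hx]] := pole_orbits N1 hfix hst; exists (val x); split; rewrite ?unitx //.
  by constructor 1; rewrite size_orb.
move: hx; rewrite -!size_orb -!card_stab => -[?|[hx hy]]; first by constructor 2.
have hN : - val x \in orb (val x).
  have mN : - val x \in poles.
    have /polesP[h1 [g g1 gx]] := ssvalP x; apply/polesP; rewrite !dot_bilin opprK h1.
    by split=> //; exists g; rewrite // mulmxN gx.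
  have := hy (SeqSub mN); rewrite -!card_stab => h.
  have /orbitP[g _ /(congr1 val) /= e] : SeqSub mN \in orbit pole_action [set: gT]%SET x.
    by apply: h; apply: eq_card => g; rewrite !inE /= mulmxN eqr_opp.
  by apply/orbP; exists g^-1%g.
by case: hx => -[h1 h2]; [constructor 3|constructor 4].
Qed.

End Poles.

(** * Orbits that come near the whole sphere *)

Section Covers.
Variable R : realType.
Implicit Types (u v w x b e f : 'cV[R]_3) (k l : 'M[R]_3) (K : set 'M[R]_3).

(** Distances are squared, t included. *)
Definition covers K x (t : R) :=
  forall b, dot b b = 1 -> exists2 k, K k & dot (b - k *m x) (b - k *m x) < t.

Lemma O3_subgroup_tr K k : O3_subgroup K -> K k -> K k^T.
Proof. by move=> [hO _ _ hV] hk; rewrite -(O3_inv (hO _ hk)); apply: hV. Qed.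

(** The distance from b to k x is that from x to a point of the orbit of b. *)
Lemma dist_adj k b x : O3 k ->
  dot (b - k *m x) (b - k *m x) = dot (k^T *m b - x) (k^T *m b - x).
Proof.
move=> hk; rewrite -[RHS](dot_O3 _ _ hk) mulmxBr mulmxA.
by have /O3P := O3_tr hk; rewrite trmxK => ->; rewrite mul1mx.
Qed.

Lemma exists_orthogonal e : exists2 f, dot f f = 1 & dot e f = 0.
Proof.
have : \det (frame e 0 0) == 0.
  apply: contraT; rewrite -unitfE -unitmxE => hM.
  have : vec3 0 1 0 = 0 :> 'cV[R]_3.
    apply: (can_inj (mulKmx hM)); rewrite mulmx0 frame_mul !mxE /=.
    by rewrite !scale0r scaler0 !addr0.
  by case/vec3_0=> _ /eqP; rewrite oner_eq0.
move=> /det0P[v v0 hv]; have x0 : v^T != 0 by rewrite -(trmx0 _ 1 3) (inj_eq trmx_inj).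
exists ((enorm v^T)^-1 *: v^T); first exact: unit_normalize.
have : (frame e 0 0)^T *m v^T = 0 by rewrite -trmx_mul hv trmx0.
by rewrite tr_frame_mul => /vec3_0[h _ _]; rewrite dotZr h mulr0.
Qed.

Lemma bessel2 e f x : dot e e = 1 -> dot f f = 1 -> dot e f = 0 ->
  dot e x ^+ 2 + dot f x ^+ 2 <= dot x x.
Proof.
move=> he hf hef; have := dot_ge0 (x - dot e x *: e - dot f x *: f).
rewrite !dot_bilin he hf hef (dotC f e) hef (dotC x e) (dotC x f); nra.
Qed.

(** All points of the orbit have the same height along the invariant line and
    the same distance to it; no choice of these brings the orbit near both the
    pole and the equator. *)
Lemma invariant_line_no_cover K x e : O3_subgroup K -> dot e e = 1 ->
  (forall k, K k -> k *m e = e \/ k *m e = - e) -> ~ covers K x 5^-1.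
Proof.
move=> hK he hline hcov; have [hO _ _ _] := hK.
have [f hf hef] := exists_orthogonal e.
have [k1 hk1] := hcov e he; have [k2 hk2] := hcov f hf.
have e1 := dot_O3 e e (O3_tr (hO _ hk1)); have f1 := dot_O3 f f (O3_tr (hO _ hk2)).
rewrite (dist_adj _ _ (hO _ hk1)) (dist_adj _ _ (hO _ hk2)).
rewrite dist_sqr ?f1 // dist_sqr ?e1 //.
set f' := k2^T *m f in f1 * => h2 h1.
have hef' : dot e f' = 0.
  rewrite -(dot_O3 _ _ (hO _ hk2)) /f' mulmxA.
  have /O3P := O3_tr (hO _ hk2); rewrite trmxK => ->; rewrite mul1mx.
  by have [->|->] := hline _ hk2; rewrite ?dot_bilin hef ?oppr0.
have := bessel2 x he (etrans f1 hf) hef'.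
have : dot (k1^T *m e) x ^+ 2 = dot e x ^+ 2.
  by have [->|->] := hline _ (O3_subgroup_tr hK hk1); rewrite ?dot_bilin ?sqrrN.
move: h1 h2; set a := dot (k1^T *m e) x; set b := dot f' x => h1 h2 ha hb.
have := sqr_ge0 (a - 2^-1); have := sqr_ge0 (b - 2^-1).
by rewrite !sqrrB; lra.
Qed.

(** Some point of each orbit lies near x, so two orbits on the sphere that
    stay far apart cannot both be within reach. Two points closer than
    sqrt (1/5) to x are closer than sqrt (4/5) to each other, that is, their
    inner product exceeds 3/5. *)
Lemma far_orbits_no_cover K x e f : O3_subgroup K -> dot e e = 1 -> dot f f = 1 ->
  (forall k, K k -> dot (k *m e) f <= 3 / 5) -> ~ covers K x 5^-1.
Proof.
move=> hK he hf hfar hcov; have [hO _ hM _] := hK.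
have [k1 hk1] := hcov e he; have [k2 hk2] := hcov f hf.
rewrite (dist_adj _ _ (hO _ hk1)) (dist_adj _ _ (hO _ hk2)).
have : dot (k1^T *m e) (k2^T *m f) <= 3 / 5.
  rewrite dotC dot_adj ?trmxK ?mulmxA; last exact/O3_tr/hO.
  by rewrite dotC; apply: hfar; apply: hM => //; apply: O3_subgroup_tr.
have : dot (k1^T *m e) (k1^T *m e) = 1 by rewrite dot_O3 //; apply/O3_tr/hO.
have : dot (k2^T *m f) (k2^T *m f) = 1 by rewrite dot_O3 //; apply/O3_tr/hO.
set E := k1^T *m e; set F := k2^T *m f => hF hE hEF h2 h1.
have := dot_ge0 (E + F - 2 *: x).
move: h1 h2; rewrite !dot_bilin hE hF (dotC F E) (dotC x E) (dotC x F); lra.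
Qed.

End Covers.

Lemma uniq_fill (T : eqType) (s t : seq T) :
  uniq s -> uniq t -> {subset s <= t} -> size t = size s -> perm_eq t s.
Proof.
move=> us ut sub st; apply: uniq_perm => // x.
by rewrite (uniq_min_size us sub _).2 // st.
Qed.

(** * Tetrahedral and octahedral groups *)

Section Cases.
Variables (R : realType) (gT : finGroupType) (rho : gT -> 'M[R]_3).
Hypotheses (rho1 : rho 1%g = 1%:M) (rhoM : {morph rho : g h / (g * h)%g >-> g *m h}).
Hypotheses (rhoO : forall g, O3 (rho g)) (rhoD : forall g, \det (rho g) = 1).
Hypothesis (rhoI : injective rho).
Implicit Types (p q u v w e f : 'cV[R]_3) (g h : gT).

Local Notation orb := (orb rho).
Local Notation stab := (stab rho).

Definition fixes_line := exists2 e, dot e e = 1 & forall g, rho g *m e = e \/ rho g *m e = - e.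

Definition far_orbits := exists e f, [/\ dot e e = 1, dot f f = 1 &
  forall g, `|dot (rho g *m e) f| <= 3 / 5].

Let orb_reflx p : p \in orb p := orb_refl rho1 p.
Let orb_actx g p v : v \in orb p -> rho g *m v \in orb p := @orb_act _ _ _ rhoM g p v.
Let dot_rhox g v w : dot (rho g *m v) (rho g *m w) = dot v w := dot_rho rhoO g v w.

Lemma fixed_vector_line v : v != 0 -> (forall g, rho g *m v = v) -> fixes_line.
Proof.
move=> v0 hv; exists ((enorm v)^-1 *: v); first exact: unit_normalize.
by move=> g; left; rewrite -scalemxAr hv.
Qed.

Lemma sum_orb_fixed p g : rho g *m (\sum_(v <- orb p) v) = \sum_(v <- orb p) v.
Proof.
rewrite mulmx_sumr -(big_map (mulmx (rho g)) xpredT id); apply: perm_big.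
have hu : uniq [seq rho g *m v | v <- orb p].
  by rewrite map_inj_uniq ?undup_uniq //; apply: can_inj (rhoVK rho1 rhoM g).
rewrite perm_sym; apply: uniq_fill => //; rewrite ?undup_uniq ?size_map //.
by move=> v /mapP[w hw ->]; apply: orb_actx.
Qed.

Lemma sum_orb p : fixes_line \/ \sum_(v <- orb p) v = 0.
Proof.
have [h|h] := eqVneq (\sum_(v <- orb p) v) 0; [by right|left].
by apply: (fixed_vector_line h) => g; apply: sum_orb_fixed.
Qed.

(** By transitivity, what holds between p and the other points of its orbit
    holds between any two points of the orbit. *)
Lemma orb_pairs p (P : R -> Prop) :
  (forall v, v \in orb p -> v <> p -> v <> - p -> P (dot p v)) ->
  forall u v, u \in orb p -> v \in orb p -> v <> u -> v <> - u -> P (dot u v).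
Proof.
move=> hP u v /orbP[g ->] hv vu vNu.
rewrite -[v](rhoKV rho1 rhoM g) dot_rhox; apply: hP; first exact: orb_actx.
- by move=> e; apply: vu; rewrite -e rhoKV.
- by move=> e; apply: vNu; rewrite -mulmxN -e rhoKV.
Qed.

(** The sum of the orbit is fixed by the group; if it vanishes, the orbit
    consists of p and - p. *)
Lemma small_orbit_line p : dot p p = 1 -> (size (orb p) <= 2)%N -> fixes_line.
Proof.
move=> hp hs; have [//|h0] := sum_orb p.
exists p => // g; have [->|/eqP gp] := eqVneq (rho g *m p) p; [by left|right].
have hu : uniq [:: p; rho g *m p] by rewrite /= inE eq_sym andbT; apply/eqP.
have hsub : {subset [:: p; rho g *m p] <= orb p}.
  by move=> v; rewrite !inE => /orP[]/eqP->; rewrite ?orb_actx ?orb_reflx.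
have : perm_eq (orb p) [:: p; rho g *m p].
  apply: uniq_fill => //; first exact: undup_uniq.
  by apply/eqP; rewrite eqn_leq hs (uniq_leq_size hu hsub).
move=> h; move: h0; rewrite (perm_big _ h) /= !big_cons big_nil addr0 addrC => /eqP.
by rewrite addr_eq0 => /eqP.
Qed.

Lemma stab_orbit_uniq p v : dot p p = 1 -> dot v v = 1 -> v <> p -> v <> - p ->
  uniq [seq rho g *m v | g <- enum (stab p)].
Proof.
move=> hp hv vp vNp; rewrite map_inj_in_uniq ?enum_uniq // => g h.
by rewrite !mem_enum => gp hhp; apply: (stab_semiregular rho1 rhoM rhoO rhoD rhoI hp hv).
Qed.

Lemma stab_height p v g : g \in stab p -> dot p (rho g *m v) = dot p v.
Proof. by rewrite inE => /eqP {1}<-; apply: dot_rhox. Qed.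

(** The stabiliser of p permutes the other three points simply transitively, so
    they are at the same height; as the sum of the orbit may be taken to vanish,
    this height is - 1/3 and the orbit is a regular tetrahedron. The second
    orbit is that of the midpoint of an edge, at inner product plus or minus
    1 / sqrt 3 < 3/5 with all vertices. *)
Lemma tetrahedral_case p : dot p p = 1 -> size (orb p) = 4 -> #|stab p| = 3 ->
  fixes_line \/ far_orbits.
Proof.
move=> hp s4 c3; have [|h0] := sum_orb p; [by left|right].
have orb1 v : v \in orb p -> dot v v = 1 by apply: orb_unit.
have [q [hq qp qNp]] : exists q, [/\ q \in orb p, q <> p & q <> - p].
  apply: contrapT => hn; suff : (size (orb p) <= size [:: p; - p])%N by rewrite s4.
  apply: uniq_leq_size; first exact: undup_uniq.
  move=> v hv; rewrite !inE; apply: contrapT => /negP; rewrite negb_or => /andP[/eqP h1 /eqP h2].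
  by apply: hn; exists v.
pose s := p :: [seq rho g *m q | g <- enum (stab p)].
have us : uniq s.
  rewrite /= stab_orbit_uniq ?orb1 // andbT; apply/mapP => -[g]; rewrite mem_enum inE => /eqP gp e.
  by apply: qp; apply: (can_inj (rhoVK rho1 rhoM g)); rewrite -e gp.
have hperm : perm_eq (orb p) s.
  apply: uniq_fill us (undup_uniq _) _ _; last by rewrite /= size_map -cardE c3 s4.
  move=> v; rewrite inE => /orP[/eqP->|/mapP[g _ ->]]; rewrite ?orb_reflx //.
  exact: orb_actx.
have hpv v : v \in orb p -> v <> p -> dot p v = dot p q.
  rewrite (perm_mem hperm) inE => /orP[/eqP->//|/mapP[g]]; rewrite mem_enum => hg -> _.
  exact: stab_height.
have hpq : dot p q = - 3^-1.
  have : dot p (\sum_(v <- orb p) v) = 0 by rewrite h0 dot0r.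
  rewrite (perm_big _ hperm) /= big_cons big_map dotDr hp dot_sumr.
  rewrite (eq_big_seq (fun _ => dot p q)) => [|g]; last first.
    by rewrite mem_enum => /stab_height.
  by rewrite big_const_seq count_predT -cardE c3 /=; lra.
have hall u v : u \in orb p -> v \in orb p -> v <> u -> dot u v = - 3^-1.
  move=> /orbP[g ->] hv vu; rewrite -[v](rhoKV rho1 rhoM g) dot_rhox -hpq; apply: hpv.
    exact: orb_actx.
  by move=> e; apply: vu; rewrite -e rhoKV.
pose t := Num.sqrt (3 / 4) : R.
have t2 : t ^+ 2 = 3 / 4 by rewrite sqr_sqrtr //; lra.
have t0 : 0 <= t by apply: sqrtr_ge0.
exists p, (t *: (p + q)); split=> //.
  by rewrite !dot_bilin hp (orb1 q) // (dotC q) hpq; nra.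
move=> g; set v := rho g *m p; have hv : v \in orb p by apply/orb_actx.
rewrite !dot_bilin normrM ger0_norm //.
have -> : `|dot v p + dot v q| = 2 / 3.
  have [->|/eqP vp] := eqVneq v p; first by rewrite hp hpq ger0_norm; lra.
  have [->|/eqP vq] := eqVneq v q; first by rewrite (dotC q) hpq orb1 // ger0_norm; lra.
  by rewrite (dotC v p) (dotC v q) !hall // ler0_norm; lra.
by nra.
Qed.

(** The stabiliser of p permutes the four points other than p and - p simply
    transitively. These points share one height and are closed under negation,
    so the height is 0: the orbit is a regular octahedron. The second orbit is
    that of a face centre, at inner product plus or minus 1 / sqrt 3 < 3/5
    with all vertices. *)
Lemma octahedral_case p : dot p p = 1 -> size (orb p) = 6 -> #|stab p| = 4 ->
  - p \in orb p -> far_orbits.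
Proof.
move=> hp s6 c4 hN.
have orb1 v : v \in orb p -> dot v v = 1 by apply: orb_unit.
have hpNp : p <> - p.
  by move=> h; have := dotNl p p; rewrite -h hp; lra.
have hperp v : v \in orb p -> v <> p -> v <> - p -> dot p v = 0.
  move=> hv vp vNp; pose s := p :: - p :: [seq rho g *m v | g <- enum (stab p)].
  have hst w : w = p \/ w = - p -> w \notin [seq rho g *m v | g <- enum (stab p)].
    move=> hw; apply/mapP => -[g]; rewrite mem_enum inE => /eqP gp e.
    have e' : v = w.
      apply: (can_inj (rhoVK rho1 rhoM g)); rewrite -e.
      by case: hw => ->; rewrite ?mulmxN gp.
    by case: hw; rewrite -e'.
  have us : uniq s.
    rewrite /= inE negb_or stab_orbit_uniq ?orb1 // !hst; try tauto.
    by rewrite !andbT; apply/eqP.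
  have hperm : perm_eq (orb p) s.
    apply: uniq_fill us (undup_uniq _) _ _; last by rewrite /= size_map -cardE c4 s6.
    move=> w; rewrite !inE => /or3P[/eqP->|/eqP->|/mapP[g _ ->]]; rewrite ?orb_reflx //.
    exact: orb_actx.
  have : - v \in s by rewrite -(perm_mem hperm); apply: (orb_opp rhoM).
  rewrite !inE => /or3P[/eqP h|/eqP h|/mapP[g]].
  - by case: vNp; rewrite -h opprK.
  - by case: vp; apply: oppr_inj.
  rewrite mem_enum => hg h; have := stab_height v hg; rewrite -h dot_bilin; lra.
have hperp2 := orb_pairs (P := fun a => a = 0) hperp.
have [q [hq qp qNp]] : exists q, [/\ q \in orb p, q <> p & q <> - p].
  apply: contrapT => hn; suff : (size (orb p) <= size [:: p; - p])%N by rewrite s6.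
  apply: uniq_leq_size; first exact: undup_uniq.
  move=> v hv; rewrite !inE; apply: contrapT => /negP; rewrite negb_or => /andP[/eqP h1 /eqP h2].
  by apply: hn; exists v.
have [r [hr rp rNp rq rNq]] : exists r, [/\ r \in orb p, r <> p, r <> - p, r <> q & r <> - q].
  apply: contrapT => hn; suff : (size (orb p) <= size [:: p; - p; q; - q])%N by rewrite s6.
  apply: uniq_leq_size; first exact: undup_uniq.
  move=> v hv; rewrite !inE; apply: contrapT => /negP; 
  rewrite !negb_or => /and4P[/eqP h1 /eqP h2 /eqP h3 /eqP h4].
  by apply: hn; exists v.
have hpq : dot p q = 0 by apply: hperp.
have hpr : dot p r = 0 by apply: hperp.
have hqr : dot q r = 0 by apply: hperp2.
have hM : frame p q r \in unitmx.
  by apply: orth_frame_unitmx => //; rewrite -dot_eq0 orb1 ?oner_eq0 // orb_reflx.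
pose t := Num.sqrt 3^-1 : R.
have t2 : t ^+ 2 = 3^-1 by rewrite sqr_sqrtr //; lra.
have t0 : 0 <= t by apply: sqrtr_ge0.
exists p, (t *: (p + q + r)); split=> //.
  rewrite !dot_bilin hp (orb1 q) // (orb1 r) // (dotC q p) (dotC r p) (dotC r q).
  by rewrite hpq hpr hqr; nra.
move=> g; set v := rho g *m p; have hv : v \in orb p by apply/orb_actx.
have v1 : dot v v = 1 by apply: orb1.
rewrite !dot_bilin normrM ger0_norm //.
have -> : `|dot v p + dot v q + dot v r| = 1.
  have [->|/eqP vp] := eqVneq v p; first by rewrite hp hpq hpr !addr0 normr1.
  have [->|/eqP vNp] := eqVneq v (- p).
    by rewrite !dot_bilin hp hpq hpr oppr0 !addr0 normrN normr1.
  have [->|/eqP vq] := eqVneq v q; first by rewrite (dotC q p) hpq hqr orb1 // addr0 add0r normr1.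
  have [->|/eqP vNq] := eqVneq v (- q).
    by rewrite !dot_bilin (dotC q p) hpq hqr orb1 // oppr0 addr0 add0r normrN normr1.
  have [->|/eqP vr] := eqVneq v r.
    by rewrite (dotC r p) (dotC r q) hpr hqr orb1 // !add0r normr1.
  have [->|/eqP vNr] := eqVneq v (- r).
    by rewrite !dot_bilin (dotC r p) (dotC r q) hpr hqr orb1 // oppr0 !add0r normrN normr1.
  have v0 : v = 0.
    by apply: (frame_ext hM); rewrite dot0r; [exact: hperp | exact: hperp2 | exact: hperp2].
  by move: v1; rewrite v0 dot0r => /esym/eqP; rewrite oner_eq0.
by nra.
Qed.

End Cases.

(** * Icosahedral groups *)

Section IcosahedralCase.
Variables (R : realType) (gT : finGroupType) (rho : gT -> 'M[R]_3).
Hypotheses (rho1 : rho 1%g = 1%:M) (rhoM : {morph rho : g h / (g * h)%g >-> g *m h}).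
Hypotheses (rhoO : forall g, O3 (rho g)) (rhoD : forall g, \det (rho g) = 1).
Hypothesis (rhoI : injective rho).
Implicit Types (p q u v w e f : 'cV[R]_3) (g h : gT).

Local Notation orb := (orb rho).
Local Notation stab := (stab rho).

Lemma stab_group_set p : group_set (stab p).
Proof.
apply/group_setP; split=> [|g h]; first by rewrite inE rho1 mul1mx.
by rewrite !inE rhoM -mulmxA => /eqP gp /eqP ->; rewrite gp.
Qed.

(** A rotation g of order five about p splits the other ten points into
    w_i = g^i q and their antipodes, so any two points of the orbit that are
    neither equal nor opposite have inner product c or - c, where c = <p, q>.
    The sum of the w_i is fixed by g, hence equal to 5 c p; taking the product
    with q gives 1 + 2 a + 2 b = 5 c^2 for a = <q, w_1> and b = <q, w_2>, both
    equal to c or - c. If a = b the five points w_i would be mutually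
    equidistant, which is impossible in a plane. So a = - b and 5 c^2 = 1, and
    one of w_1, w_2 forms a face with p and q. *)
Lemma icosahedral_case p : dot p p = 1 -> size (orb p) = 12 -> #|stab p| = 5 ->
  - p \in orb p ->
  exists q r (c : R), [/\ 0 < c, 5 * c ^+ 2 = 1,
    [/\ q \in orb p, r \in orb p, dot p q = c, dot p r = c & dot q r = c] &
    forall u v, u \in orb p -> v \in orb p -> v <> u -> v <> - u ->
      dot u v = c \/ dot u v = - c].
Proof.
move=> hp s12 c5 hN.
have orb1 v : v \in orb p -> dot v v = 1 by apply: orb_unit.
have oact g v : v \in orb p -> rho g *m v \in orb p by apply: orb_act.
have oN v : v \in orb p -> - v \in orb p by apply: (orb_opp rhoM).
have neqN v : v \in orb p -> v <> - v.
  by move=> /orb1 hv h; have := dotNl v v; rewrite -h hv; lra.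
have pin : p \in orb p by apply: orb_refl.
have [q [hq qp qNp q0]] : exists q, [/\ q \in orb p, q <> p, q <> - p & 0 <= dot p q].
  have [q [hq qp qNp]] : exists q, [/\ q \in orb p, q <> p & q <> - p].
    apply: contrapT => hn; suff : (size (orb p) <= size [:: p; - p])%N by rewrite s12.
    apply: uniq_leq_size; first exact: undup_uniq.
    move=> v hv; rewrite !inE; apply: contrapT => /negP; rewrite negb_or => /andP[/eqP h1 /eqP h2].
    by apply: hn; exists v.
  have [q0|q0] := leP 0 (dot p q); first by exists q.
  exists (- q); rewrite dotNr oppr_ge0 (ltW q0) oN //; split=> //.
    by move=> h; apply: qNp; rewrite -h opprK.
  exact/(contra_not _ qp)/oppr_inj.
set c := dot p q in q0 *.
have semi g h : g \in stab p -> h \in stab p -> rho g *m q = rho h *m q -> g = h.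
  by apply: (stab_semiregular rho1 rhoM rhoO rhoD rhoI) => //; apply: orb1.
have pow5 g : g \in stab p -> (g ^+ 5 = 1)%g.
  by move/(@expg_cardG _ (Group (stab_group_set p))); rewrite /= c5.
have stabX g i : g \in stab p -> (g ^+ i)%g \in stab p.
  exact: (@groupX _ (Group (stab_group_set p))).
have [g gp g1] : exists2 g, g \in stab p & g != 1%g.
  have : (1 < #|stab p|)%N by rewrite c5.
  rewrite (cardsD1 1%g) (group1 (Group (stab_group_set p))) ltnS => /card_gt0P[g].
  by rewrite !inE => /andP[g1 gp]; exists g; rewrite ?inE.
have og : #[g]%g = 5.
  have := order_dvdn g 5; rewrite pow5 // eqxx => h.
  by have := @primeP 5 isT => -[_ /(_ _ h)/orP[|/eqP->//]]; rewrite order_eq1 (negPf g1).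
pose w i := rho (g ^+ i)%g *m q.
have w0 : w 0%N = q by rewrite /w expg0 rho1 mul1mx.
have win i : w i \in orb p by apply: oact.
have w5 i : w (i + 5)%N = w i by rewrite /w expgD pow5 // mulg1.
have dotw i d : dot (w i) (w (i + d)%N) = dot q (w d).
  by rewrite /w expgD rhoM -mulmxA dot_rho.
have dotpw i : dot p (w i) = c by apply: (stab_height rhoO); apply: stabX.
have wp i : w i <> p /\ w i <> - p.
  have := stabX _ i gp; rewrite inE => /eqP gip.
  split=> h; [apply: qp | apply: qNp]; apply: (can_inj (rhoVK rho1 rhoM (g ^+ i)%g)).
    by rewrite gip.
  by rewrite mulmxN gip.
have winj i j : (i < 5)%N -> (j < 5)%N -> w i = w j -> i = j.
  move=> hi hj /semi; rewrite !stabX // => /(_ isT isT)/eqP.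
  by rewrite eq_expg_mod_order og !modn_small // => /eqP.
have wN i j : (j < 5)%N -> w i <> - w j.
  move=> hj hij; pose k := (g ^+ (i + (5 - j)))%g.
  have kp : k \in stab p by apply: stabX.
  have hk : w (i + (5 - j))%N = - q.
    have -> : w (i + (5 - j))%N = rho (g ^+ (5 - j))%g *m w i.
      by rewrite /w addnC expgD rhoM mulmxA.
    rewrite hij mulmxN /w mulmxA -rhoM -expgD subnK ?(ltnW hj) //.
    by rewrite pow5 // rho1 mul1mx.
  have k2 : (k ^+ 2 = 1)%g.
    apply: semi; [exact: stabX | by rewrite inE rho1 mul1mx|].
    by rewrite rho1 mul1mx expgS expg1 rhoM -mulmxA -/(w _) hk mulmxN -/(w _) hk opprK.
  have k1 : k = 1%g.
    by rewrite -(pow5 k) // (expgD k 4 1) (expgM k 2 2) k2 expg1n mul1g expg1.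
  by have := neqN _ hq; rewrite -hk /w -/k k1 rho1 mul1mx.
pose A := [seq w i | i <- iota 0 5].
have hperm : perm_eq (orb p) (p :: - p :: A ++ [seq - v | v <- A]).
  have memA v : v \in A -> exists2 i, (i < 5)%N & v = w i.
    by case/mapP=> i; rewrite mem_iota => hi ->; exists i.
  apply: uniq_fill (undup_uniq _) _ _; last by rewrite s12.
    have uA : uniq A.
      by rewrite map_inj_in_uniq ?iota_uniq // => i j; rewrite !mem_iota; apply: winj.
    have pA v : v = p \/ v = - p -> v \notin A ++ [seq - v | v <- A].
      move=> hv; rewrite mem_cat; apply/negP => /orP[/memA[i _ e]|/mapP[x /memA[i _ ->] e]].
        by have [] := wp i; rewrite -e; case: hv.
      have [] := wp i; have -> : w i = - v by rewrite e opprK.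
      by case: hv => ->; rewrite ?opprK; tauto.
    rewrite 2!cons_uniq in_cons negb_or !pA ?andbT; [|by right|by left].
    apply/andP; split; first by apply/eqP/neqN.
    rewrite cat_uniq uA map_inj_uniq ?uA ?andbT ?andTb; last exact: oppr_inj.
    apply/hasPn => v /mapP[x /memA[j hj ->] ->]; apply/negP => /memA[i _].
    by move/esym/wN; apply.
  move=> v; rewrite 2!in_cons mem_cat.
  move=> /or4P[/eqP->|/eqP->|/memA[i _ ->]|/mapP[x /memA[i _ ->] ->]] //.
  exact: oN.
have hpc v : v \in orb p -> v <> p -> v <> - p -> dot p v = c \/ dot p v = - c.
  rewrite (perm_mem hperm) 2!in_cons mem_cat.
  move=> /or4P[/eqP->|/eqP->|/mapP[i _ ->]|/mapP[x /mapP[i _ ->] ->]] //; first by left.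
  by right; rewrite dotNr dotpw.
have hpairs := orb_pairs rho1 rhoM rhoO (P := fun a => a = c \/ a = - c) hpc.
pose a := dot q (w 1%N); pose b := dot q (w 2%N).
have ha3 : dot q (w 3%N) = b by rewrite -(dotw 2%N) (w5 0%N) w0 dotC.
have ha4 : dot q (w 4%N) = a by rewrite -(dotw 1%N) (w5 0%N) w0 dotC.
have hqq : dot q q = 1 by apply: orb1.
have hsum : 1 + 2 * a + 2 * b = 5 * c ^+ 2.
  pose s := q + w 1%N + w 2%N + w 3%N + w 4%N.
  have gw i : rho g *m w i = w i.+1 by rewrite /w expgS rhoM mulmxA.
  have gs : rho g *m (s - (5 * c) *: p) = s - (5 * c) *: p.
    move: gp; rewrite inE mulmxBr -scalemxAr => /eqP ->; congr (_ - _).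
    by rewrite /s !mulmxDr -{1}w0 !gw (w5 0%N) w0 addrC !addrA.
  have ps : dot p (s - (5 * c) *: p) = 0.
    by rewrite /s !dot_bilin !dotpw hp -/c; ring.
  have [y0|y0] := eqVneq (s - (5 * c) *: p) 0; last first.
    case/eqP: g1; set y := s - _ in gs ps y0.
    have py : dot p ((enorm y)^-1 *: y) = 0 by rewrite dotZr ps mulr0.
    apply: (stab_semiregular rho1 rhoM rhoO rhoD rhoI hp (unit_normalize y0)) => //.
    - by move=> h; move: py; rewrite h hp; lra.
    - by move=> h; move: py; rewrite h dotNr hp; lra.
    - by rewrite inE rho1 mul1mx.
    - by rewrite rho1 mul1mx -scalemxAr gs.
  have := dot0r q; rewrite -{1}y0 /s !dot_bilin hqq ha3 ha4 -/a -/b (dotC q p) -/c; lra.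
have hd i : (0 < i < 5)%N -> dot q (w i) = c \/ dot q (w i) = - c.
  move=> /andP[i0 i5]; apply: hpairs => //; rewrite -w0.
    by move=> /winj h; have := h i5 isT; move: i0 => /[swap] ->.
  exact: wN.
have hab : a <> b.
  (* If a = b then w_1 - w_2 and w_0 - w_3 are orthogonal, and w_4 is
     orthogonal to both, hence on the axis. *)
  move=> ab; have neq i j : (i < 5)%N -> (j < 5)%N -> (i != j)%N -> w i - w j != 0.
    by move=> hi hj ij; rewrite subr_eq0; apply: contra ij => /eqP/winj->.
  have d10 : dot (w 1%N) (w 0%N) = a by rewrite dotC w0.
  have d13 : dot (w 1%N) (w 3%N) = b by rewrite (dotw 1%N 2%N).
  have d20 : dot (w 2%N) (w 0%N) = b by rewrite dotC w0.
  have d23 : dot (w 2%N) (w 3%N) = a by rewrite (dotw 2%N 1%N).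
  have d14 : dot (w 1%N) (w 4%N) = b by rewrite (dotw 1%N 3%N).
  have d24 : dot (w 2%N) (w 4%N) = b by rewrite (dotw 2%N 2%N).
  have d04 : dot (w 0%N) (w 4%N) = a by rewrite w0.
  have d34 : dot (w 3%N) (w 4%N) = a by rewrite (dotw 3%N 1%N).
  have hM : frame p (w 1%N - w 2%N) (w 0%N - w 3%N) \in unitmx.
    apply: orth_frame_unitmx; rewrite ?neq //.
    - by rewrite -dot_eq0 hp oner_eq0.
    - by rewrite !dot_bilin !dotpw subrr.
    - by rewrite !dot_bilin !dotpw subrr.
    - by rewrite !dot_bilin d10 d13 d20 d23 ab; ring.
  have e4 : w 4%N = c *: p.
    apply: (frame_ext hM); rewrite !dot_bilin ?dotpw ?hp ?mulr1 //.
      by rewrite d14 d24 !(dotC _ p) !dotpw; ring.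
    by rewrite d04 d34 !(dotC _ p) !dotpw; ring.
  have h4 := orb1 _ (win 4%N).
  have [] // := unit_dot_sqr1 hp h4; last 2 first.
  - by move=> e; case: (wp 4%N) => + _; rewrite -e.
  - by move=> e; case: (wp 4%N) => _ +; rewrite e opprK.
  by rewrite dotpw; move: h4; rewrite {1}e4 dotZl dotpw.
have hc1 : c != 0.
  apply/eqP => c0; move: hsum; rewrite /a /b c0.
  by have [->|->] := hd 1%N isT; have [->|->] := hd 2%N isT; rewrite c0; lra.
have cpos : 0 < c by rewrite lt_def hc1.
have [hA hB] := (hd 1%N isT, hd 2%N isT).
have [hac|hbc] : (a = c /\ b = - c) \/ (b = c /\ a = - c).
- by move: hab; rewrite /a /b; case: hA => ->; case: hB => ->; tauto.
- exists q, (w 1%N), c; split=> //; first by move: hsum; rewrite hac.1 hac.2; lra.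
  by split=> //; exact: hac.1.
- exists q, (w 2%N), c; split=> //; first by move: hsum; rewrite hbc.1 hbc.2; lra.
  by split=> //; exact: hbc.1.
Qed.

End IcosahedralCase.

(** * Computation in the ring of the golden ratio *)

(** The pair (a, b) stands for a + b phi in Z[phi]. *)
Definition zphi : Type := (int * int)%type.
Definition zadd (a b : zphi) : zphi := (a.1 + b.1, a.2 + b.2).
Definition zopp (a : zphi) : zphi := (- a.1, - a.2).
Definition zmul (a b : zphi) : zphi :=
  (a.1 * b.1 + a.2 * b.2, a.1 * b.2 + a.2 * b.1 + a.2 * b.2).
(** Sufficient for a + b phi >= 0, because phi lies between 8/5 and 13/8. *)
Definition zge0 (a : zphi) : bool :=
  (0 <= 5 * a.1 + 8 * a.2) && (0 <= 8 * a.1 + 13 * a.2).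

(** Coordinates in the basis of fundamental weights, which is dual to the inner
    normals of the cone: the closed chamber consists of the vectors with
    nonnegative coordinates. *)
Definition zvec : Type := (zphi * zphi * zphi)%type.

(** The simple reflections, in terms of the Cartan matrix with off-diagonal
    entries -1, - phi and 0. *)
Definition zgen (i : nat) (x : zvec) : zvec :=
  let: (a, b, c) := x in
  match i with
  | 0 => (zopp a, zadd b a, c)
  | 1 => (zadd a b, zopp b, zadd c (zmul (0, 1) b))
  | _ => (a, zadd b (zmul (0, 1) c), zopp c)
  end.

Definition zact (w : seq nat) (x : zvec) : zvec := foldr zgen x w.

Definition zbasis (i : nat) : zvec :=
  match i with
  | 0 => ((1, 0), (0, 0), (0, 0))
  | 1 => ((0, 0), (1, 0), (0, 0))
  | _ => ((0, 0), (0, 0), (1, 0))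
  end.

(** The inner product, through the Gram matrix of the weights. *)
Definition zdot (x y : zvec) : zphi :=
  let: (a, b, c) := x in let: (a', b', c') := y in
  let g11 := zmul (2, 1) (zmul a a') in
  let g12 := zmul (2, 2) (zadd (zmul a b') (zmul b a')) in
  let g13 := zmul (1, 2) (zadd (zmul a c') (zmul c a')) in
  let g22 := zmul (4, 4) (zmul b b') in
  let g23 := zmul (2, 4) (zadd (zmul b c') (zmul c b')) in
  let g33 := zmul (3, 3) (zmul c c') in
  zadd g11 (zadd g12 (zadd g13 (zadd g22 (zadd g23 g33)))).

Definition zcode (w : seq nat) :=
  [seq zact w (zbasis i) | i <- iota 0 3].

(** Twelve elements sending the first weight, which is on a fivefold axis, to
    the twelve vertices of the icosahedron; eleven of them are the suffixes of
    one reduced word. The stabiliser of that weight is the dihedral group of the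
    other two reflections, so 12 * 10 products exhaust the group. *)
Definition vertex_words : seq (seq nat) :=
  [:: 2; 1; 2; 1; 0]%N ::
  [seq drop i [:: 0; 1; 2; 1; 2; 0; 1; 2; 1; 0]%N | i <- iota 0 11].
Definition dihedral_words : seq (seq nat) :=
  [seq take i [:: 1; 2; 1; 2; 1]%N | i <- iota 0 6] ++
  [seq take i [:: 2; 1; 2; 1]%N | i <- iota 1 4].
Definition h3_words : seq (seq nat) :=
  [seq v ++ d | v <- vertex_words, d <- dihedral_words].

Lemma h3_codes_uniq : uniq [seq zcode w | w <- h3_words].
Proof. by vm_compute. Qed.

Lemma h3_codes_closed :
  all (fun i => all (fun w => zcode (i :: w) \in [seq zcode w | w <- h3_words]) h3_words)
    (iota 0 3).
Proof. by vm_compute. Qed.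

(** A weight minus any of its images is nonnegative on the chamber. *)
Lemma h3_codes_dominant :
  all (fun w => all (fun i => all (fun j =>
    zge0 (zadd (zdot (zbasis i) (zbasis j))
               (zopp (zdot (zbasis i) (zact w (zbasis j))))))
    (iota 0 3)) (iota 0 3)) h3_words.
Proof. by vm_compute. Qed.

Definition zvertices := [seq zact w (zbasis 0) | w <- vertex_words].

Definition zface (i : nat) : zvec := zact (nth [::] [:: [::]; [:: 0]; [:: 1; 0]]%N i) (zbasis 0).

Definition zface_image (w : seq nat) := [seq zact w (zface i) | i <- iota 0 3].

(** Vertices have squared norm phi + 2, and adjacent ones have product phi. *)
Lemma h3_faces :
  let faces := [seq zface_image w | w <- h3_words] in
  all (fun u => all (fun v => (zdot u v == (0, 1)) ==>
    all (fun w => (zdot u w == (0, 1)) && (zdot v w == (0, 1)) ==>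
      ([:: u; v; w] \in faces))
    zvertices) zvertices) zvertices.
Proof. by vm_compute. Qed.

(** * The golden ratio and the angle pi / 5 *)

Section GoldenRatio.
Variable R : realType.

Definition phi : R := (1 + Num.sqrt 5) / 2.

Lemma phi_sqr : phi ^+ 2 = phi + 1.
Proof.
have h : Num.sqrt 5 ^+ 2 = 5 :> R by rewrite sqr_sqrtr //; lra.
by rewrite /phi; nra.
Qed.

Lemma phi_bounds : 55 / 34 < phi < 34 / 21.
Proof.
have h := phi_sqr; have h0 : 0 < phi by rewrite divr_gt0 // ltr_pwDl // sqrtr_ge0.
by apply/andP; split; nra.
Qed.

(** The angle x = pi / 5 satisfies cos (3 x) = - cos (2 x), so its cosine is a
    root of (c + 1) (4 c^2 - 2 c - 1). *)
Lemma cos_pi5 : cos (pi / 5) = phi / 2 :> R.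
Proof.
set x : R := pi / 5; set c := cos x.
have c0 : 0 < c.
  by apply: cos_gt0_pihalf; have := pi_gt0 R; rewrite /x => h; apply/andP; split; lra.
have c2 : cos (x *+ 2) = 2 * c ^+ 2 - 1 by rewrite cos_mulr2n mulr_natl.
have c3 : cos (x *+ 2 + x) = 4 * c ^+ 3 - 3 * c.
  by rewrite cosD c2 sin_mulr2n -/c; have := sin2cos2 x; rewrite -/c; nra.
have : cos (x *+ 2 + x) = - cos (x *+ 2).
  have -> : x *+ 2 + x = pi - x *+ 2 by rewrite /x; field.
  by rewrite cosB cospi sinpi; ring.
rewrite c2 c3 => h.
have : (c + 1) * (4 * c ^+ 2 - 2 * c - 1) = 0 by move: h; nra.
move/eqP; rewrite mulf_eq0 gt_eqF ?addr_gt0 //= => /eqP h2.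
have hphi := phi_sqr; have /andP[hp _] := phi_bounds.
have : (c - phi / 2) * (c + phi / 2 - 1 / 2) = 0 by nra.
move/eqP; rewrite mulf_eq0 => /orP[/eqP|/eqP]; first lra.
by nra.
Qed.

Lemma nu2E : nu2 R = vec3 ((phi - 1) / 2) (phi / 2) (1 / 2).
Proof.
rewrite /nu2 cos_pi5; congr vec3.
have hphi := phi_sqr; have /andP[hp _] := phi_bounds.
have -> : 3 / 4 - (phi / 2) ^+ 2 = ((phi - 1) / 2) ^+ 2 by nra.
by rewrite sqrtr_sqr ger0_norm //; lra.
Qed.

(** Parity of the 5-adic valuation. *)
Lemma int_sqr5 (x y : int) : x ^+ 2 = 5 * y ^+ 2 -> y = 0.
Proof.
move=> /(congr1 absz); rewrite abszM !abszX => h.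
apply/eqP; rewrite -absz_eq0; apply: contraT; rewrite -lt0n => y0.
have x0 : (0 < `|x|)%N by move: h y0; case: `|x|%N => // h; case: `|y|%N h.
have := congr1 (logn 5) h.
by rewrite lognM ?expn_gt0 ?y0 // !lognX /= (_ : logn 5 5 = 1%N) //; lia.
Qed.

Definition zeval (a : zphi) : R := a.1%:~R + a.2%:~R * phi.

(** phi is irrational. *)
Lemma zeval_inj : injective zeval.
Proof.
suff h0 (a b : int) : a%:~R + b%:~R * phi = 0 -> a = 0 /\ b = 0.
  move=> [a b] [a' b'] h; have [] := h0 (a - a') (b - b').
    by move: h; rewrite /zeval /= !rmorphB /=; lra.
  by move=> /subr0_eq-> /subr0_eq->.
move=> h; have hphi := phi_sqr.
have e : (2 * a + b) ^+ 2 = 5 * b ^+ 2.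
  apply: (@intr_inj R); rewrite !(rmorphXn, rmorphD, rmorphM) /=; nra.
have b0 := int_sqr5 e; split=> //.
by apply: (@intr_inj R); move: h; rewrite b0 mul0r addr0.
Qed.

Lemma zeval_add a b : zeval (zadd a b) = zeval a + zeval b.
Proof. by rewrite /zeval /= !rmorphD /=; ring. Qed.

Lemma zeval_opp a : zeval (zopp a) = - zeval a.
Proof. by rewrite /zeval /= !rmorphN /=; ring. Qed.

Lemma zeval_mul a b : zeval (zmul a b) = zeval a * zeval b.
Proof. 
have hphi := phi_sqr.
by rewrite /zeval /= !rmorphD !rmorphM /=; ring: hphi.
Qed.

Lemma zge0P a : zge0 a -> 0 <= zeval a.
Proof.
rewrite /zge0 -!(ler0z R) !rmorphD !rmorphM /= => /andP[h1 h2].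
have /andP[p1 p2] := phi_bounds.
by rewrite /zeval; nra.
Qed.

End GoldenRatio.

(** * The reflection group and its chamber *)

Section IcosahedralGroup.
Variable R : realType.
Implicit Types (u v x y : 'cV[R]_3) (w : seq nat).
Local Notation phi := (phi R).
Local Notation zeval := (zeval R).

Definition mirror (i : nat) : 'cV[R]_3 :=
  match i with 0 => nu1 R | 1 => nu2 R | _ => nu3 R end.

Definition word_mx w : 'M[R]_3 :=
  foldr (fun i M => reflection (mirror i) *m M) 1%:M w.

(** The dual basis to - nu1, nu2, - nu3; these vectors span the fivefold,
    twofold and threefold edges of the cone. *)
Definition weight (i : nat) : 'cV[R]_3 :=
  match i with
  | 0 => vec3 phi 0 (- 1)
  | 1 => vec3 (2 * phi) 0 0
  | _ => vec3 (phi + 1) (- 1) 0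
  end.

Definition zev (x : zvec) : 'cV[R]_3 :=
  zeval x.1.1 *: weight 0 + zeval x.1.2 *: weight 1 + zeval x.2 *: weight 2.

Lemma zevE (x : zvec) : zev x =
  vec3 (zeval x.1.1 * phi + zeval x.1.2 * (2 * phi) + zeval x.2 * (phi + 1))
       (- zeval x.2) (- zeval x.1.1).
Proof. by apply: vec3_eq; rewrite !mxE /=; ring. Qed.

Lemma reflection_mul u v : reflection u *m v = v - (2 * dot u v) *: u.
Proof.
rewrite /reflection mulmxBl mul1mx -scalemxAl -mulmxA; congr (_ - _).
have -> : u^T *m v = (dot u v)%:M.
  by apply/matrixP => i j; rewrite !ord1 [RHS]mxE eqxx mulr1n dot_mulmx.
by rewrite mul_mx_scalar scalerA.
Qed.

Lemma reflection_O3 u : dot u u = 1 -> O3 (reflection u).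
Proof.
move=> hu; apply: O3_dot => x y; rewrite !reflection_mul !dot_bilin hu (dotC x u).
by ring.
Qed.

Lemma reflectionK u : dot u u = 1 -> reflection u *m reflection u = 1%:M.
Proof.
move=> hu; have /O3P := reflection_O3 hu; congr (_ *m _ = _).
apply/matrixP => i j; rewrite !mxE eq_sym; congr (_ - _ * _).
by apply: eq_bigr => m _; rewrite !mxE mulrC.
Qed.

Lemma mirror_unit i : dot (mirror i) (mirror i) = 1.
Proof.
have hphi := phi_sqr R.
by case: i => [|[|i]]; rewrite /mirror ?nu2E dot_vec3; [ring|nra|ring].
Qed.

Lemma zeval_phi : zeval (0, 1) = phi.
Proof. by rewrite /zeval /= mul1r add0r. Qed.

Lemma reflection_zev i (x : zvec) : reflection (mirror i) *m zev x = zev (zgen i x).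
Proof.
have hphi := phi_sqr R; case: x => [[a b] c].
case: i => [|[|i]]; rewrite reflection_mul /mirror ?nu2E !zevE /nu1 /nu3 dot_vec3 /=;
  rewrite !(zeval_add, zeval_opp, zeval_mul) ?zeval_phi.
all: apply: vec3_eq; rewrite !mxE /=; try by field: hphi.
Qed.

Lemma word_mx_zev w (x : zvec) : word_mx w *m zev x = zev (zact w x).
Proof.
by elim: w => [|i w ih] /=; rewrite ?mul1mx // -mulmxA ih reflection_zev.
Qed.

Lemma dot_zev (x y : zvec) : dot (zev x) (zev y) = zeval (zdot x y).
Proof.
have hphi := phi_sqr R; case: x y => [[a b] c] [[a' b'] c'].
rewrite !zevE dot_vec3 /zdot !(zeval_add, zeval_mul) /= /zeval /=; ring: hphi.
Qed.

Lemma zev_inj : injective zev.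
Proof.
move=> [[a b] c] [[a' b'] c']; rewrite !zevE /= => h.
have /andP[hp _] := phi_bounds R.
have e3 : zeval c = zeval c'.
  by have := congr1 (fun v : 'cV[R]_3 => v 1 0) h; rewrite !mxE /= => /oppr_inj.
have e1 : zeval a = zeval a'.
  by have := congr1 (fun v : 'cV[R]_3 => v 2%:R 0) h; rewrite !mxE /= => /oppr_inj.
have e2 : zeval b = zeval b'.
  have := congr1 (fun v : 'cV[R]_3 => v 0 0) h; rewrite !mxE /= e1 e3.
  by move=> /addIr/addrI/mulIf; apply; rewrite gt_eqF //; lra.
by rewrite (zeval_inj e1) (zeval_inj e2) (zeval_inj e3).
Qed.

Lemma zev_basis i : (i < 3)%N -> zev (zbasis i) = weight i.
Proof.
by case: i => [|[|[|//]]] _; rewrite zevE /zeval /=; apply: vec3_eq; rewrite !mxE /=; ring.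
Qed.

Lemma weight_frame : frame (weight 0) (weight 1) (weight 2) \in unitmx.
Proof.
have /andP[hp _] := phi_bounds R.
have p0 : 2 * phi != 0 by rewrite gt_eqF //; lra.
apply: inj_unitmx => x; rewrite frame_mul => h.
have h1 := congr1 (fun v : 'cV[R]_3 => v 1 0) h.
have h2 := congr1 (fun v : 'cV[R]_3 => v 2%:R 0) h.
have h0 := congr1 (fun v : 'cV[R]_3 => v 0 0) h.
move: h0 h1 h2; rewrite !mxE /= => h0 h1 h2.
have e2 : x 2%:R 0 = 0 by lra.
have e0 : x 0 0 = 0 by lra.
move: h0; rewrite e0 e2 mul0r mul0r addr0 add0r => /eqP.
rewrite mulf_eq0 (negPf p0) orbF => /eqP e1.
by apply: vec3_eq; rewrite mxE.
Qed.

Lemma zcode_nth w i : (i < 3)%N -> nth (zbasis 0) (zcode w) i = zact w (zbasis i).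
Proof. by case: i => [|[|[|//]]]. Qed.

Lemma word_mx_weight w i : (i < 3)%N -> word_mx w *m weight i = zev (zact w (zbasis i)).
Proof. by move=> hi; rewrite -zev_basis // word_mx_zev. Qed.

Lemma word_mx_code w w' : zcode w = zcode w' <-> word_mx w = word_mx w'.
Proof.
split=> h.
  by apply: (frame_mx_ext weight_frame); rewrite !word_mx_weight // -!zcode_nth // h.
have e i : (i < 3)%N -> zact w (zbasis i) = zact w' (zbasis i).
  by move=> hi; apply: zev_inj; rewrite -!word_mx_weight // h.
by rewrite /zcode; apply/eq_in_map => i; rewrite mem_iota => /e.
Qed.

(** The list contains the identity and is closed under left multiplication by
    the generators. *)
Lemma word_listed w : exists2 w', w' \in h3_words & word_mx w = word_mx w'.
Proof.
elim: w => [|i w [w' hw' e]]; first by exists [::].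
have [j [hj ej]] : exists j, (j < 3)%N /\ mirror i = mirror j.
  by case: i => [|[|i]]; [exists 0%N|exists 1%N|exists 2%N].
have /allP/(_ j) := h3_codes_closed; rewrite mem_iota => /(_ hj)/allP/(_ w' hw')/mapP[w2 hw2 e2].
exists w2 => //; rewrite /= e ej -[LHS]/(word_mx (j :: w')).
exact/word_mx_code.
Qed.

Lemma word_mx_cat w w' : word_mx (w ++ w') = word_mx w *m word_mx w'.
Proof. by elim: w => [|i w ih] /=; rewrite ?mul1mx // ih mulmxA. Qed.

Lemma word_mx_rev w : word_mx (rev w) *m word_mx w = 1%:M.
Proof.
elim: w => [|i w ih]; first by rewrite mulmx1.
rewrite rev_cons -cats1 word_mx_cat /= mulmx1 -mulmxA (mulmxA (reflection _)).
by rewrite reflectionK ?mirror_unit // mul1mx.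
Qed.

Lemma word_mx_O3 w : O3 (word_mx w).
Proof.
elim: w => [|i w ih]; first exact: O3_1.
by apply: O3_mul => //; apply/reflection_O3/mirror_unit.
Qed.

Lemma words_subgroup : O3_subgroup (range word_mx).
Proof.
split.
- by move=> _ [w _ <-]; apply: word_mx_O3.
- by exists [::].
- by move=> _ _ [w _ <-] [w' _ <-]; exists (w ++ w'); rewrite // word_mx_cat.
- move=> _ [w _ <-]; exists (rev w) => //.
  rewrite O3_inv; last exact: word_mx_O3.
  have /O3P h := word_mx_O3 w.
  by rewrite -[LHS]mulmx1 -(mulmx1C h) mulmxA word_mx_rev mul1mx.
Qed.

(** Reversing a word inverts it, so the products of generators already form a
    group. *)
Lemma H3E : @H3 R = range word_mx.
Proof.
apply/seteqP; split.
  apply: smallest_sub; first exact: words_subgroup.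
  move=> k [[->|->]|->]; [exists [:: 0%N]|exists [:: 1%N]|exists [:: 2%N]] => //=; exact: mulmx1.
move=> _ [w _ <-] X [[hO h1 hM hV] hX].
elim: w => [|i w ih] //=; apply: hM => //; apply: hX.
by case: i => [|[|i]]; [left; left|left; right|right].
Qed.

Lemma H3_subgroup : O3_subgroup (@H3 R).
Proof. by rewrite H3E; apply: words_subgroup. Qed.

Lemma H3_list : @H3 R = [set` [seq word_mx w | w <- h3_words]].
Proof.
rewrite H3E; apply/seteqP; split=> [_ [w _ <-]|k /mapP[w _ ->]]; last by exists w.
by have [w' hw' ->] := word_listed w; apply/mapP; exists w'.
Qed.

Lemma weight_dominant w i j : (i < 3)%N -> (j < 3)%N ->
  dot (weight i) (word_mx w *m weight j) <= dot (weight i) (weight j).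
Proof.
have [w' hw' ->] := word_listed w => hi hj.
have /allP/(_ w' hw')/allP/(_ i) := h3_codes_dominant.
rewrite mem_iota => /(_ hi)/allP/(_ j); rewrite mem_iota => /(_ hj)/(zge0P R).
by rewrite zeval_add zeval_opp subr_ge0 -!dot_zev -word_mx_zev !zev_basis.
Qed.

Lemma weight_coord x :
  x = (- dot x (nu1 R)) *: weight 0 + dot x (nu2 R) *: weight 1 + (- dot x (nu3 R)) *: weight 2.
Proof.
have hphi := phi_sqr R.
by apply: vec3_eq; rewrite !mxE /= nu2E /nu1 /nu3 !dotE !mxE /=; field: hphi.
Qed.

Lemma H3_coneP x : H3_cone x ->
  exists a b c, [/\ 0 <= a, 0 <= b, 0 <= c & x = a *: weight 0 + b *: weight 1 + c *: weight 2].
Proof.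
case=> h1 h2 h3; exists (- dot x (nu1 R)), (dot x (nu2 R)), (- dot x (nu3 R)).
by rewrite !oppr_ge0; split=> //; apply: weight_coord.
Qed.

Lemma cone_dominant w i x : (i < 3)%N -> H3_cone x ->
  dot (weight i) (word_mx w *m x) <= dot (weight i) x.
Proof.
move=> hi /H3_coneP[a [b [c [a0 b0 c0 ->]]]].
rewrite !mulmxDr -!scalemxAr !dot_bilin.
by rewrite !lerD // ler_wpM2l // weight_dominant.
Qed.

(** An element fixing an interior point fixes every weight, because each
    term of the pairing can only decrease. *)
Lemma interior_free w a b c (x := a *: weight 0 + b *: weight 1 + c *: weight 2) :
  0 < a -> 0 < b -> 0 < c -> word_mx w *m x = x -> word_mx w = 1%:M.
Proof.
move=> a0 b0 c0 wx.
have hj j : (j < 3)%N -> word_mx w *m weight j = weight j.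
  move=> hj; have h : dot x (word_mx w *m weight j) = dot x (weight j).
    by rewrite -{1}wx dot_O3 //; apply: word_mx_O3.
  have d i := weight_dominant w (i := i) (j := j).
  have := d 0%N isT hj; have := d 1%N isT hj; have := d 2%N isT hj.
  move: h; rewrite /x !dotDl !dotZl.
  set d0 := dot (weight 0) _; set d1 := dot (weight 1) _; set d2 := dot (weight 2) _.
  set e0 := dot (weight 0) _; set e1 := dot (weight 1) _; set e2 := dot (weight 2) _.
  move=> h h2 h1 h0.
  have m0 : 0 <= a * (e0 - d0) by rewrite mulr_ge0 ?subr_ge0 // ltW.
  have m1 : 0 <= b * (e1 - d1) by rewrite mulr_ge0 ?subr_ge0 // ltW.
  have m2 : 0 <= c * (e2 - d2) by rewrite mulr_ge0 ?subr_ge0 // ltW.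
  have z t s r : 0 < t -> 0 <= t * (s - r) -> t * (s - r) <= 0 -> r = s :> R.
    move=> t0 h1' h2'; have /eqP : t * (s - r) = 0 by lra.
    by rewrite mulf_eq0 gt_eqF //= => /eqP/subr0_eq.
  apply: (frame_ext weight_frame); [apply: (z a)|apply: (z b)|apply: (z c)] => //;
    rewrite -?/d0 -?/d1 -?/d2 -?/e0 -?/e1 -?/e2; nra.
by apply: (frame_mx_ext weight_frame); rewrite mul1mx hj.
Qed.

(** The element maximising the pairing with an interior point brings x into
    the chamber, since crossing a mirror on the wrong side would increase it. *)
Lemma chamber_exists x : exists w, H3_cone (word_mx w *m x).
Proof.
(* The sum of the weights has product 1 with each inner normal. *)
pose ro := weight 0 + weight 1 + weight 2.
pose F (i : 'I_(size h3_words)) := dot ro (word_mx (nth [::] h3_words i) *m x).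
pose i0 : 'I_(size h3_words) := Ordinal (isT : (0 < size h3_words)%N).
have [i _ hi] := Order.TotalTheory.arg_maxP F (isT : predT i0).
exists (nth [::] h3_words i).
have hmax w : dot ro (word_mx w *m x) <= F i.
  have [w' hw' ->] := word_listed w.
  have hs : (index w' h3_words < size h3_words)%N by rewrite index_mem.
  by have := hi (Ordinal hs) isT; rewrite /F /= nth_index.
have hm j : dot ro (reflection (mirror j) *m (word_mx (nth [::] h3_words i) *m x)) <= F i.
  by rewrite mulmxA; apply: (hmax (j :: _)).
have hroE : ro = vec3 (4 * phi + 1) (- 1) (- 1).
  by apply: vec3_eq; rewrite !mxE /=; ring.
have hphi := phi_sqr R.
move: hm; rewrite /F; set y := word_mx _ *m x => hm.
have hm' j : 0 <= dot (mirror j) y * dot ro (mirror j).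
  have := hm j; rewrite reflection_mul !dot_bilin; lra.
split.
- by have := hm' 0%N; rewrite /= {2}/nu1 hroE dot_vec3 dotC; lra.
- have := hm' 1%N; rewrite /= {2}nu2E hroE dot_vec3 dotC.
  suff -> : (4 * phi + 1) * ((phi - 1) / 2) + -1 * (phi / 2) + -1 * (1 / 2) = 1 by rewrite mulr1.
  by field: hphi.
- by have := hm' 2%N; rewrite /= {2}/nu3 hroE dot_vec3 dotC; lra.
Qed.

Definition face i : 'cV[R]_3 := zev (zface i).

Lemma face_frame : frame (face 0) (face 1) (face 2) \in unitmx.
Proof.
have /andP[hp _] := phi_bounds R.
apply: inj_unitmx => x; rewrite frame_mul /face !zevE /zeval /= => h.
have h1 := congr1 (fun v : 'cV[R]_3 => v 1 0) h.
have h2 := congr1 (fun v : 'cV[R]_3 => v 2%:R 0) h.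
have h0 := congr1 (fun v : 'cV[R]_3 => v 0 0) h.
move: h0 h1 h2; rewrite !mxE /= => h0 h1 h2.
apply: vec3_eq; rewrite mxE; nra.
Qed.

(** An orthogonal matrix sending the three corners of a face to vertices is
    in the group: the group is transitive on ordered triples of adjacent
    vertices. *)
Lemma face_stabilizer k : O3 k ->
  (forall i, (i < 3)%N -> exists2 v, v \in zvertices & k *m face i = zev v) ->
  exists w, k = word_mx w.
Proof.
move=> hk hv.
have [v0 m0 e0] := hv 0%N isT; have [v1 m1 e1] := hv 1%N isT; have [v2 m2 e2] := hv 2%N isT.
have hd i j (u v : zvec) : k *m face i = zev u -> k *m face j = zev v ->
    zdot u v = zdot (zface i) (zface j).
  by move=> ei ej; apply: (@zeval_inj R); rewrite -!dot_zev -ei -ej dot_O3.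
have d01 : zdot v0 v1 = (0, 1) by rewrite (hd _ _ _ _ e0 e1); vm_compute.
have d02 : zdot v0 v2 = (0, 1) by rewrite (hd _ _ _ _ e0 e2); vm_compute.
have d12 : zdot v1 v2 = (0, 1) by rewrite (hd _ _ _ _ e1 e2); vm_compute.
have /allP/(_ v0 m0)/allP/(_ v1 m1) := h3_faces.
rewrite d01 eqxx => /allP/(_ v2 m2); rewrite d02 d12 eqxx => /mapP[w _ ew]; exists w.
move: ew; rewrite /zface_image /= => -[w0 w1 w2].
apply: (frame_mx_ext face_frame).
- by rewrite e0 w0 -word_mx_zev.
- by rewrite e1 w1 -word_mx_zev.
- by rewrite e2 w2 -word_mx_zev.
Qed.

End IcosahedralGroup.

(** * The Chebyshev center of the chamber *)

Section ChebyshevCenter.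
Variable R : realType.
Implicit Types (u v x y c : 'cV[R]_3).
Local Notation phi := (phi R).

Definition corner i : 'cV[R]_3 := (enorm (weight R i))^-1 *: weight R i.

Lemma sqrt_eq (a b : R) : 0 <= b -> b ^+ 2 = a -> Num.sqrt a = b.
Proof. by move=> b0 <-; rewrite sqrtr_sqr ger0_norm. Qed.

Lemma enorm_weight : [/\ enorm (weight R 0) = Num.sqrt (phi + 2),
  enorm (weight R 1) = 2 * phi & enorm (weight R 2) = Num.sqrt 3 * phi].
Proof.
have hphi := phi_sqr R; have /andP[hp _] := phi_bounds R.
have h3 : Num.sqrt 3 ^+ 2 = 3 :> R by rewrite sqr_sqrtr //; lra.
have s3 := sqrtr_ge0 (3 : R).
split; rewrite /enorm /= dot_vec3; first by congr Num.sqrt; nra.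
- by apply: sqrt_eq; [lra | ring].
- by apply: sqrt_eq; [rewrite mulr_ge0 //; lra | rewrite exprMn h3; nra].
Qed.

Lemma enorm_weight_gt0 i : 0 < enorm (weight R i).
Proof.
have /andP[hp _] := phi_bounds R.
have [e0 e1 e2] := enorm_weight.
case: i => [|[|i]].
- by rewrite e0 sqrtr_gt0; lra.
- by rewrite e1; lra.
- by rewrite -[weight R i.+2]/(weight R 2) e2 mulr_gt0 ?sqrtr_gt0; lra.
Qed.

Lemma corner_unit i : dot (corner i) (corner i) = 1.
Proof.
apply: unit_normalize; rewrite -dot_eq0 -enorm_sqr sqrf_eq0.
by rewrite gt_eqF // enorm_weight_gt0.
Qed.

Lemma weight_corner i : weight R i = enorm (weight R i) *: corner i.
Proof. by rewrite scalerA divff ?scale1r // gt_eqF // enorm_weight_gt0. Qed.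

Lemma corner_cone i : H3_cone (corner i).
Proof.
have hphi := phi_sqr R; have /andP[hp _] := phi_bounds R.
have n0 := enorm_weight_gt0 i.
have [h1 h2 h3] : H3_cone (weight R i).
  by case: i {n0} => [|[|i]]; split; rewrite /= ?nu2E dot_vec3; nra.
by split; rewrite dotZl (pmulr_rle0, pmulr_rge0) ?invr_gt0.
Qed.

(** The circumcentre w / |w|^2 of the corners p_i, where w is the vector with
    <w, p_i> = 1 for all i; that it has positive barycentric coordinates says
    that the triangle of corners is acute. *)
Lemma circumcenter_exists : exists c (l : nat -> R),
  [/\ forall i, 0 < l i, l 0%N + l 1%N + l 2%N = 1,
      c = l 0%N *: corner 0 + l 1%N *: corner 1 + l 2%N *: corner 2,
      forall i, (i < 3)%N -> dot c (corner i) = dot c c & 4 / 5 < dot c c].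
Proof.
have hphi := phi_sqr R; have /andP[p1 p2] := phi_bounds R.
have [e0 e1 e2] := enorm_weight.
set b := Num.sqrt (phi + 2) in e0; set a := Num.sqrt 3 in e2.
have a0 : 0 <= a by apply: sqrtr_ge0.
have b0 : 0 <= b by apply: sqrtr_ge0.
have ha : a ^+ 2 = 3 by rewrite sqr_sqrtr //; lra.
have hb : b ^+ 2 = phi + 2 by rewrite sqr_sqrtr //; lra.
(* Approximations of sqrt 3 and sqrt (phi + 2) fine enough for hm2 and S1. *)
have a1 : 19 / 11 < a by nra.
have a2 : a < 26 / 15 by nra.
have b1 : 19 / 10 < b by nra.
have b2 : b < 59 / 31 by nra.
(* The solution of <w, p_i> = 1; below, m5 * b, m2 and m3 * a are its
   coordinates in the corners. *)
pose w : 'cV[R]_3 := vec3 1 (- (a - phi) * phi) (- (b - phi)).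
have wc i : (i < 3)%N -> dot w (corner i) = 1.
  move=> hi; rewrite dotZr; apply: (mulfI (x := enorm (weight R i))).
    by rewrite gt_eqF // enorm_weight_gt0.
  rewrite mulVKf ?gt_eqF ?enorm_weight_gt0 // mulr1.
  by case: i hi => [|[|[|//]]] _; rewrite ?e0 ?e1 ?e2 dot_vec3; ring: hphi.
pose m3 := phi ^+ 2 * (a - phi); pose m5 := b - phi; pose m2 := 1 - phi * (m3 + m5).
have phi0 : 0 < phi by lra.
have m30 : 0 < m3 by rewrite /m3 mulr_gt0 ?exprn_gt0 // subr_gt0; lra.
have hm3 : 0 < m3 * a by rewrite mulr_gt0 //; lra.
have hm5 : 0 < m5 * b by rewrite mulr_gt0 // /m5; lra.
have hm2 : 0 < m2.
  have -> : m2 = 1 - (2 * phi + 1) * (a - phi) - phi * (b - phi) by rewrite /m2 /m3 /m5; ring: hphi.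
  nra.
have wE : w = (m5 * b) *: corner 0 + m2 *: corner 1 + (m3 * a) *: corner 2.
  rewrite /corner e0 e1 e2 !scalerA.
  have -> : m5 * b / b = m5 by rewrite mulfK // gt_eqF //; lra.
  have -> : m3 * a / (a * phi) = phi * (a - phi).
    by rewrite /m3; field; rewrite !gt_eqF //; lra.
  apply: vec3_eq; rewrite !mxE /=.
  - have -> : m2 / (2 * phi) * (2 * phi) = m2 by rewrite divfK // gt_eqF //; lra.
    by rewrite /m2 /m3 /m5; ring: hphi.
  - by ring.
  - by rewrite /m5; ring.
set S := m5 * b + m2 + m3 * a.
have wS : dot w w = S.
  rewrite {2}wE; have := wc 0%N isT; have := wc 1%N isT; have := wc 2%N isT.
  move: (corner 0) (corner 1) (corner 2) => q0 q1 q2 h2 h1 h0.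
  by rewrite !dot_bilin h0 h1 h2 !mulr1.
have S0 : 0 < S := addr_gt0 (addr_gt0 hm5 hm2) hm3.
have S1 : S < 5 / 4.
  rewrite -wS dot_vec3; have : (a - phi) * phi < 1 / 5 by nra.
  have : 0 < (a - phi) * phi by rewrite mulr_gt0 //; lra.
  by move: ((a - phi) * phi) => t t0 t1; nra.
pose l i := match i with 0 => m5 * b / S | 1 => m2 / S | _ => m3 * a / S end.
exists (S^-1 *: w), l; split.
- by case=> [|[|i]]; rewrite /l divr_gt0.
- by rewrite /l -!mulrDl divff // gt_eqF.
- by rewrite {1}wE !scalerDr !scalerA /l !(mulrC S^-1).
- by move=> i hi; rewrite dotZl wc // dotZl dotZr wS mulVf // gt_eqF.
- rewrite dotZl dotZr wS mulVf ?gt_eqF // mulr1.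
  have -> : 4 / 5 = (5 / 4)^-1 :> R by rewrite invf_div.
  by rewrite ltf_pV2 ?posrE // divr_gt0.
Qed.

(** Expanding the squares, the terms linear in y combine into the product
    with c. *)
Lemma weighted_dist c (l : nat -> R) y : l 0%N + l 1%N + l 2%N = 1 ->
  c = l 0%N *: corner 0 + l 1%N *: corner 1 + l 2%N *: corner 2 ->
  l 0%N * dot (corner 0 - y) (corner 0 - y) + l 1%N * dot (corner 1 - y) (corner 1 - y)
    + l 2%N * dot (corner 2 - y) (corner 2 - y)
  = 1 - dot c c + dot (y - c) (y - c).
Proof.
move=> hl hc.
have -> : 1 - dot c c + dot (y - c) (y - c) = 1 - 2 * dot c y + dot y y.
  by rewrite !dot_bilin (dotC y c); ring.
rewrite (dist_sqr _ (corner_unit 0)) (dist_sqr _ (corner_unit 1)) (dist_sqr _ (corner_unit 2)).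
rewrite {}hc; move: (corner 0) (corner 1) (corner 2) hl => p0 p1 p2.
move: (l 0%N) (l 1%N) (l 2%N) => l0 l1 l2 hl.
have -> : l2 = 1 - l0 - l1 by rewrite -hl; ring.
by rewrite !dot_bilin; ring.
Qed.

(** The ball about the circumcentre meets the sphere in the cap cut off by the
    plane of the corners, and the chamber lies beyond that plane. *)
Lemma domain_in_cap c x : (forall i, (i < 3)%N -> dot c (corner i) = dot c c) ->
  H3_domain x -> dot c c <= dot c x.
Proof.
move=> + [/H3_coneP[a0 [a1 [a2 [h0 h1 h2 xE]]]] /unit_sphereP hx].
move: xE; rewrite (weight_corner 0) (weight_corner 1) (weight_corner 2).
have := enorm_weight_gt0 0; have := enorm_weight_gt0 1; have := enorm_weight_gt0 2.
set n0 := enorm (weight R 0); set n1 := enorm (weight R 1); set n2 := enorm (weight R 2).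
move: corner_unit; move: corner => p p1 n2p n1p n0p; rewrite !scalerA => xE hc.
have t0 : 0 <= a0 * n0 by rewrite mulr_ge0 // ltW.
have t1 : 0 <= a1 * n1 by rewrite mulr_ge0 // ltW.
have t2 : 0 <= a2 * n2 by rewrite mulr_ge0 // ltW.
have hs : 1 <= a0 * n0 + a1 * n1 + a2 * n2.
  have hle t i : 0 <= t -> t * dot (p i) x <= t.
    by move=> h; rewrite ler_piMr // unit_dot_le1.
  rewrite -{1}hx {1}xE !dot_bilin.
  by apply: lerD; first apply: lerD; apply: hle.
rewrite xE !dot_bilin !hc // -!mulrDl.
by rewrite -[leLHS]mul1r ler_wpM2r // dot_ge0.
Qed.

(** A ball of center y and radius r containing the corners satisfies
    1 - |c|^2 + |y - c|^2 <= r^2 by the weighted identity; the ball about c attains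
    equality, so it is minimal and unique. *)
Lemma chebyshev_center_H3 (c := chebyshev_center (@H3_domain R)) :
  [/\ exists a : nat -> R, (forall i, 0 < a i) /\
        c = a 0%N *: weight R 0 + a 1%N *: weight R 1 + a 2%N *: weight R 2,
      4 / 5 < dot c c,
      forall x, H3_domain x -> dot (x - c) (x - c) <= 1 - dot c c &
      forall y, exists2 i, (i < 3)%N & 1 - dot c c <= dot (corner i - y) (corner i - y)].
Proof.
have [d [l [l0 l1 hd hdc d45]]] := circumcenter_exists.
have dle : dot d d <= 1.
  have := dot_ge0 (corner 0 - d); rewrite dist_sqr ?corner_unit //.
  by rewrite dotC hdc //; lra.
have hcap x : H3_domain x -> dot (x - d) (x - d) <= 1 - dot d d.
  move=> hx; have := domain_in_cap hdc hx; case: hx => _ /unit_sphereP hx.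
  by rewrite dist_sqr // (dotC x); lra.
have hcorner i : H3_domain (corner i).
  by split; [exact: corner_cone | apply/unit_sphereP/corner_unit].
have hbig y r : @H3_domain R `<=` euclid_cball y r ->
    0 <= r /\ 1 - dot d d + dot (y - d) (y - d) <= r ^+ 2.
  move=> hr; have hri i : dot (corner i - y) (corner i - y) <= r ^+ 2.
    have := hr _ (hcorner i); rewrite /euclid_cball /= -enorm_sqr.
    by have := enorm_ge0 (corner i - y); nra.
  split; first exact: le_trans (enorm_ge0 _) (hr _ (hcorner 0%N)).
  rewrite -(weighted_dist y l1 hd).
  have -> : r ^+ 2 = l 0%N * r ^+ 2 + l 1%N * r ^+ 2 + l 2%N * r ^+ 2.
    by rewrite -!mulrDl l1 mul1r.
  by rewrite !lerD // ler_wpM2l // ltW.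
have hball : @H3_domain R `<=` euclid_cball d (Num.sqrt (1 - dot d d)).
  by move=> x /hcap h; rewrite /euclid_cball /= /enorm ler_wsqrtr.
have dc : is_chebyshev_center (@H3_domain R) d.
  exists (Num.sqrt (1 - dot d d)); split=> // y r /hbig[r0 hr].
  rewrite -[leRHS]ger0_norm // -sqrtr_sqr ler_wsqrtr //.
  by have := dot_ge0 (y - d); lra.
have -> : c = d.
  have [r [hr hmin]] : is_chebyshev_center (@H3_domain R) c :=
    xgetI (P := [set y | is_chebyshev_center (@H3_domain R) y]) 0 dc.
  have [r0 hr2] := hbig _ _ hr.
  have := hmin _ _ hball; rewrite -(@ler_sqr _ r) ?nnegrE ?sqrtr_ge0 // sqr_sqrtr; last lra.
  move=> h; apply/eqP; rewrite -subr_eq0 -dot_eq0 eq_le dot_ge0 andbT; lra.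
split=> //.
- exists (fun i => l i / enorm (weight R i)); split=> [i|].
    by rewrite divr_gt0 // enorm_weight_gt0.
  by rewrite {1}hd /corner !scalerA.
- move=> y; apply: contrapT => hn.
  have hlt i : (i < 3)%N -> dot (corner i - y) (corner i - y) < 1 - dot d d.
    by move=> hi; rewrite ltNge; apply/negP => h; apply: hn; exists i.
  have := weighted_dist y l1 hd; apply/eqP; rewrite lt_eqF //.
  have -> : 1 - dot d d = l 0%N * (1 - dot d d) + l 1%N * (1 - dot d d) + l 2%N * (1 - dot d d).
    by rewrite -!mulrDl l1 mul1r.
  have hm i : (i < 3)%N -> l i * dot (corner i - y) (corner i - y) < l i * (1 - dot d d).
    by move=> /hlt h; rewrite ltr_pM2l.
  by rewrite ltr_wpDr ?dot_ge0 // !ltrD ?hm.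
Qed.

End ChebyshevCenter.

(** * Finite subgroups of O(3) *)

Section MatrixGroup.
Variable R : realType.

Lemma matrix_finGroup (s : seq 'M[R]_3) : 1%:M \in s ->
  {in s &, forall k l, k *m l \in s} -> {in s, forall k, k^T \in s} ->
  {in s, forall k, O3 k} ->
  exists (gT : finGroupType) (rho : gT -> 'M[R]_3),
  [/\ rho 1%g = 1%:M, {morph rho : g h / (g * h)%g >-> g *m h}, injective rho,
      forall g, rho g \in s & forall k, k \in s -> exists g, rho g = k].
Proof.
move=> s1 sM sT sO.
pose T := seq_sub s.
pose mul (x y : T) : T := SeqSub (sM _ _ (ssvalP x) (ssvalP y)).
pose one : T := SeqSub s1.
pose inv (x : T) : T := SeqSub (sT _ (ssvalP x)).
have mulA : associative mul by move=> x y z; apply: val_inj; rewrite /= mulmxA.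
have mul1 : left_id one mul by move=> x; apply: val_inj; rewrite /= mul1mx.
have mulV : left_inverse one inv mul.
  by move=> x; apply: val_inj; rewrite /=; apply/O3P/sO/ssvalP.
pose gT : finGroupType := HB.pack T (Finite_isGroup.Build T mulA mul1 mulV).
exists gT, (fun g : gT => ssval (g : T)); split=> //.
- exact: val_inj.
- by move=> g; apply: ssvalP.
- by move=> k hk; exists (SeqSub hk).
Qed.

End MatrixGroup.

Section LowerBound.
Variable R : realType.
Implicit Types (u v x y p q r : 'cV[R]_3) (k : 'M[R]_3) (K : set 'M[R]_3).
Local Notation phi := (phi R).

(** Products with the corners of a face, which determine a vector. *)
Definition zdots (z : zvec) :=
  (zdot z (zface 0), zdot z (zface 1), zdot z (zface 2)).

Lemma dots_vertex y (a b c : zphi) : (a, b, c) \in map zdots zvertices ->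
  dot y (face R 0) = zeval R a -> dot y (face R 1) = zeval R b -> dot y (face R 2) = zeval R c ->
  exists2 z, z \in zvertices & y = zev R z.
Proof.
case/mapP=> z hz [-> -> ->] h0 h1 h2; exists z => //.
apply: (frame_ext (face_frame R)); rewrite ![dot (face R _) _]dotC.
- by rewrite h0 dot_zev.
- by rewrite h1 dot_zev.
- by rewrite h2 dot_zev.
Qed.

Lemma zeval_phi_opp : zeval R (0, -1) = - phi.
Proof. by rewrite /zeval /= mulN1r add0r. Qed.

Lemma zeval_norm : zeval R (2, 1) = phi + 2.
Proof. by rewrite /zeval /= mul1r addrC. Qed.

Lemma equal_dots_norm f0 f1 f2 y (e : R) : frame f0 f1 f2 \in unitmx ->
  dot f0 f0 = phi + 2 -> dot f1 f1 = phi + 2 -> dot f2 f2 = phi + 2 ->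
  dot f0 f1 = phi -> dot f0 f2 = phi -> dot f1 f2 = phi ->
  dot y f0 = e -> dot y f1 = e -> dot y f2 = e ->
  (3 * phi + 2) * dot y y = 3 * e ^+ 2.
Proof.
move=> hM h00 h11 h22 h01 h02 h12 h0 h1 h2.
have yE : (3 * phi + 2) *: y = e *: (f0 + f1 + f2).
  apply: (frame_ext hM); rewrite !dot_bilin ?(dotC _ y) ?(dotC f1 f0) ?(dotC f2 f0) ?(dotC f2 f1).
  - by rewrite h0 h00 h01 h02; ring.
  - by rewrite h1 h11 h01 h12; ring.
  - by rewrite h2 h22 h02 h12; ring.
by rewrite -dotZr yE !dot_bilin h0 h1 h2; ring.
Qed.

(** A vector of the norm of a vertex whose product with each corner of a face
    is plus or minus phi is a vertex: the two all-equal sign patterns would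
    force it to be a multiple of the face centre, of the wrong norm. *)
Lemma sign_pattern_vertex y : dot y y = phi + 2 ->
  (forall i, (i < 3)%N -> dot y (face R i) = phi \/ dot y (face R i) = - phi) ->
  exists2 z, z \in zvertices & y = zev R z.
Proof.
move=> hy hd; have hphi := phi_sqr R; have /andP[p1 p2] := phi_bounds R.
have vphi := zeval_phi R; have vNphi := zeval_phi_opp.
have dE i j : dot (face R i) (face R j) = zeval R (zdot (zface i) (zface j)) := dot_zev _ _ _.
have center e : dot y (face R 0) = e -> dot y (face R 1) = e -> dot y (face R 2) = e ->
    e ^+ 2 = phi ^+ 2 -> False.
  move=> h0 h1 h2 he; have : (3 * phi + 2) * dot y y = 3 * e ^+ 2.
    apply: (equal_dots_norm (face_frame R)) => //; rewrite dE -?zeval_norm -?zeval_phi;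
      by congr (zeval R _); vm_compute.
  by rewrite hy he; nra.
have [h0|h0] := hd 0%N isT; have [h1|h1] := hd 1%N isT; have [h2|h2] := hd 2%N isT.
- by case: (center phi).
- by apply: (@dots_vertex y (0, 1) (0, 1) (0, -1)); rewrite ?vphi ?vNphi //; vm_compute.
- by apply: (@dots_vertex y (0, 1) (0, -1) (0, 1)); rewrite ?vphi ?vNphi //; vm_compute.
- by apply: (@dots_vertex y (0, 1) (0, -1) (0, -1)); rewrite ?vphi ?vNphi //; vm_compute.
- by apply: (@dots_vertex y (0, -1) (0, 1) (0, 1)); rewrite ?vphi ?vNphi //; vm_compute.
- by apply: (@dots_vertex y (0, -1) (0, 1) (0, -1)); rewrite ?vphi ?vNphi //; vm_compute.
- by apply: (@dots_vertex y (0, -1) (0, -1) (0, 1)); rewrite ?vphi ?vNphi //; vm_compute.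
- by case: (center (- phi)); rewrite // sqrrN.
Qed.

Lemma face_vertex i : (i < 3)%N -> (exists2 z, z \in zvertices & face R i = zev R z) /\
  (exists2 z, z \in zvertices & - face R i = zev R z).
Proof.
have dE i' j : dot (face R i') (face R j) = zeval R (zdot (zface i') (zface j)) := dot_zev _ _ _.
move=> hi; split.
  by exists (zface i) => //; case: i hi => [|[|[|//]]] _; vm_compute.
pose d j := zopp (zdot (zface i) (zface j)).
apply: (@dots_vertex _ (d 0%N) (d 1%N) (d 2%N)).
- by rewrite /d; case: i hi {d} => [|[|[|//]]] _; vm_compute.
all: by rewrite dotNl dE /d zeval_opp.
Qed.

End LowerBound.

Section Bound.
Variable R : realType.
Implicit Types (u v x y p q r : 'cV[R]_3) (k : 'M[R]_3) (K : set 'M[R]_3).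
Local Notation phi := (phi R).

(** K is conjugate to a subgroup of H3. *)
Definition standard K := exists2 T : 'M[R]_3, O3 T &
  forall k, K k -> exists w, T^T *m k *m T = word_mx R w.

(** An icosahedral orbit is a scaled copy of the vertex set, and symmetries of
    the latter belong to the reflection group. *)
Lemma standard_of_orbit K (P : 'cV[R]_3 -> Prop) p q r (c : R) :
  K `<=` @O3 R -> (forall k v, K k -> P v -> P (k *m v)) ->
  0 < c -> 5 * c ^+ 2 = 1 ->
  P p -> P q -> P r -> (forall v, P v -> dot v v = 1) ->
  dot p q = c -> dot p r = c -> dot q r = c ->
  (forall u v, P u -> P v -> v <> u -> v <> - u -> dot u v = c \/ dot u v = - c) ->
  standard K.
Proof.
move=> hO hP c0 c2 Pp Pq Pr P1 pq pr qr hc.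
have hphi := phi_sqr R; have /andP[p1 _] := phi_bounds R.
pose s := Num.sqrt (phi + 2).
have s2 : s * s = phi + 2 by rewrite -expr2 sqr_sqrtr //; lra.
have cphi : c * (phi + 2) = phi.
  have /eqP : (c * (phi + 2)) ^+ 2 = phi ^+ 2 by nra.
  rewrite eqf_sqr => /orP[/eqP//|/eqP]; nra.
have dE i j : dot (face R i) (face R j) = zeval R (zdot (zface i) (zface j)) := dot_zev _ _ _.
have [T [hT T0 T1 T2]] : exists T : 'M[R]_3, [/\ O3 T, T *m face R 0 = s *: p,
    T *m face R 1 = s *: q & T *m face R 2 = s *: r].
  apply: (congruent_frames (face_frame R)); rewrite dE dotZl dotZr mulrA s2 ?P1 ?pq ?pr ?qr //.
  1-3: by rewrite mulr1 -zeval_norm; congr (zeval R _); vm_compute.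
  1-3: by rewrite mulrC cphi -zeval_phi; congr (zeval R _); vm_compute.
have TK u : T^T *m (T *m u) = u by rewrite mulmxA (O3P _).1 // mul1mx.
pose corners i := match i with 0 => p | 1 => q | _ => r end.
have Tc i : (i < 3)%N -> T *m face R i = s *: corners i by case: i => [|[|[|//]]].
have Pc i : P (corners i) by case: i => [|[|i]].
have vertex v : P v -> exists2 z, z \in zvertices & T^T *m (s *: v) = zev R z.
  move=> Pv.
  have [[i hi [hv|hv]]|hn] := pselect (exists2 i, (i < 3)%N & v = corners i \/ v = - corners i).
  - by rewrite hv -Tc // TK; exact: (face_vertex R hi).1.
  - by rewrite hv scalerN -Tc // mulmxN TK; exact: (face_vertex R hi).2.
  apply: sign_pattern_vertex.
    by rewrite dot_O3 ?dotZl ?dotZr ?mulrA ?s2 ?P1 ?mulr1 //; apply: O3_tr.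
  move=> i hi; have -> : dot (T^T *m (s *: v)) (face R i) = (phi + 2) * dot (corners i) v.
    rewrite -{1}(TK (face R i)) dot_O3 ?Tc //; last exact: O3_tr.
    by rewrite dotZl dotZr mulrA s2 dotC.
  have [||->|->] := hc _ _ (Pc i) Pv.
  - by move=> e; apply: hn; exists i => //; left.
  - by move=> e; apply: hn; exists i => //; right.
  - by left; rewrite mulrC.
  - by right; rewrite mulrN mulrC cphi.
exists T => // k Kk; apply: face_stabilizer.
  by apply: O3_mul => //; apply: O3_mul; [exact: O3_tr|exact: hO].
move=> i hi; rewrite -!mulmxA Tc // -scalemxAr; apply: vertex; exact: hP.
Qed.

(** The rotations l with l or - l in K form a finite group, and each element of
    K is one of them up to sign. The orbit counting for that group gives the
    alternatives, which tolerate the sign. *)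
Lemma finite_O3_classification K : O3_subgroup K -> finite_set K ->
  [\/ exists2 e, dot e e = 1 & forall k, K k -> k *m e = e \/ k *m e = - e,
      exists e f, [/\ dot e e = 1, dot f f = 1 & forall k, K k -> dot (k *m e) f <= 3 / 5] |
      standard K].
Proof.
move=> hK /finite_seqP[sK sKE]; have [hO h1 hM _] := hK.
have hmem k : K k <-> k \in sK by rewrite sKE.
pose s := [seq k <- sK ++ [seq - k | k <- sK] | \det k == 1].
have sP k : (k \in s) <-> (\det k = 1 /\ (K k \/ K (- k))).
  rewrite mem_filter mem_cat.
  split=> [/andP[/eqP -> /orP[/hmem|/mapP[l /hmem Kl ->]]]|[-> [/hmem ->|/hmem Kk]]].
  - by split=> //; left.
  - by split=> //; right; rewrite opprK.
  - by rewrite eqxx.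
  - by rewrite eqxx /=; apply/orP; right; apply/mapP; exists (- k); rewrite ?opprK.
have sO k : k \in s -> O3 k.
  by move=> /sP[_ [/hO//|/hO/O3_opp]]; rewrite opprK.
have s1 : 1%:M \in s by apply/sP; rewrite det1; split=> //; left.
have sM : {in s &, forall k l, k *m l \in s}.
  move=> k l /sP[dk hk] /sP[dl hl]; apply/sP; rewrite det_mulmx dk dl mulr1; split=> //.
  case: hk => hk; case: hl => hl; have := hM _ _ hk hl;
    rewrite ?mulNmx ?mulmxN ?opprK; tauto.
have sT : {in s, forall k, k^T \in s}.
  move=> k /sP[dk hk]; apply/sP; rewrite det_tr; split=> //.
  by case: hk => /(O3_subgroup_tr hK); [left|rewrite linearN; right].
have [gT [rho [rho1 rhoM rhoI rhos srho]]] := matrix_finGroup s1 sM sT sO.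
have rhoO g : O3 (rho g) by apply/sO/rhos.
have rhoD g : \det (rho g) = 1 by have /sP[] := rhos g.
have hKrho k : K k -> exists g, k = rho g \/ k = - rho g.
  move=> Kk; have [dk|dk] := O3_det (hO _ Kk).
    by have [|g <-] := srho k; [apply/sP; split=> //; left|exists g; left].
  have [|g hg] := srho (- k); last by exists g; right; rewrite hg opprK.
  apply/sP; rewrite opprK; split; last by right.
  by rewrite -scaleN1r detZ dk -signr_odd /= expr1 mulrNN mulr1.
have line : fixes_line rho -> exists2 e, dot e e = 1 & forall k, K k -> k *m e = e \/ k *m e = - e.
  move=> [e he hg]; exists e => // k /hKrho[g [->|->]]; first exact: hg.
  by rewrite mulNmx; have [->|->] := hg g; [right|left; rewrite opprK].
have far : far_orbits rho ->
    exists e f, [/\ dot e e = 1, dot f f = 1 & forall k, K k -> dot (k *m e) f <= 3 / 5].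
  move=> [e [f [he hf hef]]]; exists e, f; split=> // k /hKrho[g [->|->]].
    exact: le_trans (ler_norm _) (hef g).
  by rewrite mulNmx dotNl (le_trans (ler_norm _)) // normrN.
have [p [hp [hs|[s4 c3]|[s6 c4 hN]|[s12 c5 hN]]]] := rotation_group_poles rho1 rhoM rhoO rhoD rhoI.
- by constructor 1; apply/line/(small_orbit_line rho1 rhoM hp).
- have [h|h] := tetrahedral_case rho1 rhoM rhoO rhoD rhoI hp s4 c3.
    by constructor 1; apply: line.
  by constructor 2; apply: far.
- by constructor 2; apply/far/(octahedral_case rho1 rhoM rhoO rhoD rhoI hp s6 c4 hN).
constructor 3.
have [q [r [c [c0 c2 [hq hr pq pr qr] hc]]]] :=
  icosahedral_case rho1 rhoM rhoO rhoD rhoI hp s12 c5 hN.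
apply: (@standard_of_orbit K (fun v => v \in orb rho p) p q r c) => //.
- move=> k v /hKrho[g [->|->]] hv; first exact: orb_act.
  by rewrite mulNmx (orb_opp rhoM hN) // orb_act.
- exact: orb_refl.
- by move=> v; apply: orb_unit.
Qed.

(** Move x into the chamber by an element of the group: there x is at least
    as close to each corner as any other point of its orbit, so the bound on
    the distance to the farthest corner applies to x itself. *)
Lemma standard_no_cover K x (t : R) : O3_subgroup K -> standard K ->
  (forall y, exists2 i, (i < 3)%N & t <= dot (corner R i - y) (corner R i - y)) ->
  ~ covers K x t.
Proof.
move=> [hO _ _ _] [T hT hK] hfar hcov.
have [w0 hy] := chamber_exists (T^T *m x).
set g0 := word_mx R w0 in hy; set y := g0 *m _ in hy.
have hg0 : O3 g0 := @word_mx_O3 R w0.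
have [i hi hti] := hfar y.
have hb : dot (T *m g0^T *m corner R i) (T *m g0^T *m corner R i) = 1.
  by rewrite dot_O3 ?corner_unit //; apply: O3_mul => //; apply: O3_tr.
have [k Kk] := hcov _ hb.
have [w hw] := hK _ Kk.
have hS : O3 (g0 *m T^T) by apply: O3_mul => //; apply: O3_tr.
have trS : (g0 *m T^T)^T = T *m g0^T by rewrite trmx_mul trmxK.
rewrite -(dot_O3 _ _ hS) mulmxBr.
have -> : g0 *m T^T *m (T *m g0^T *m corner R i) = corner R i.
  have /O3P := O3_tr hS; rewrite trmxK -trS => h.
  by rewrite mulmxA h mul1mx.
have -> : g0 *m T^T *m (k *m x) = word_mx R (w0 ++ w ++ rev w0) *m y.
  rewrite !word_mx_cat -hw /y.
  rewrite -!mulmxA (mulmxA (word_mx R (rev w0))) word_mx_rev mul1mx.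
  by rewrite (mulmxA T); have /O3P := O3_tr hT; rewrite trmxK => ->; rewrite mul1mx.
apply/negP; rewrite -leNgt (le_trans hti) //.
rewrite !(dist_sqr _ (corner_unit R i)) (dot_O3 _ _ (@word_mx_O3 R _)).
rewrite lerD2r lerD2l lerN2 ler_pM2l // !dotZl.
by rewrite ler_wpM2l ?invr_ge0 ?enorm_ge0 // cone_dominant.
Qed.

End Bound.

(** * Hausdorff distance to the sphere *)

Section Hausdorff.
Variable R : realType.
Implicit Types (a b c x : 'cV[R]_3) (A B : set 'cV[R]_3) (K : set 'M[R]_3).

Lemma dist_to_has_lbound B a : has_lbound [set enorm (a - b) | b in B].
Proof. by exists 0 => _ [b _ <-]; apply: enorm_ge0. Qed.

Lemma dist_to_le B a b : B b -> dist_to B a <= enorm (a - b).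
Proof. by move=> hb; apply: ge_inf; [exact: dist_to_has_lbound | exists b]. Qed.

Lemma hausdorff_dist_le A B (r : R) : A !=set0 -> B !=set0 ->
  (forall a, A a -> exists2 b, B b & enorm (a - b) <= r) ->
  (forall b, B b -> exists2 a, A a & enorm (b - a) <= r) ->
  hausdorff_dist A B <= r.
Proof.
move=> [a0 ha0] [b0 hb0] hA hB; rewrite /hausdorff_dist ge_max; apply/andP; split.
  apply: ge_sup; first by exists (dist_to B a0), a0.
  by move=> _ [a ha <-]; have [b hb] := hA a ha; apply/le_trans/dist_to_le.
apply: ge_sup; first by exists (dist_to A b0), b0.
by move=> _ [b hb <-]; have [a ha] := hB b hb; apply/le_trans/dist_to_le.
Qed.

(** The supremum over the sphere is finite because the orbit contains x. *)
Lemma hausdorff_dist_covers K x (r : R) : O3_subgroup K ->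
  hausdorff_dist (orbit3 K x) (@unit_sphere R) < r -> covers K x (r ^+ 2).
Proof.
move=> [hO h1 _ _]; rewrite /hausdorff_dist gt_max => /andP[_ hr] b hb.
have hx : orbit3 K x x by exists 1%:M; rewrite ?mul1mx.
have hub : has_ubound [set dist_to (orbit3 K x) b | b in @unit_sphere R].
  exists (Num.sqrt (2 + 2 * dot x x)) => _ [d /unit_sphereP hd <-].
  apply: le_trans (dist_to_le d hx) _; rewrite ler_wsqrtr //.
  by have := dot_ge0 (d + x); rewrite dist_sqr // !dot_bilin hd (dotC x d); lra.
have : dist_to (orbit3 K x) b < r.
  by apply: le_lt_trans hr; apply: ub_le_sup => //; exists b => //; apply/unit_sphereP.
move=> /inf_lt[|_ [_ [k Kk <-] <-] hlt].
  by exists (enorm (b - x)), x.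
exists k => //; rewrite -enorm_sqr ltr_pXn2r ?nnegrE ?enorm_ge0 //.
exact: le_trans (enorm_ge0 _) (ltW hlt).
Qed.

End Hausdorff.

Lemma uniq_map_inj_in (T U : eqType) (f : T -> U) (s : seq T) :
  uniq (map f s) -> {in s &, injective f}.
Proof.
elim: s => //= x s ih /andP[fx us] y z.
rewrite !inE => /predU1P[->|ys] /predU1P[->|zs] e //; last exact: ih.
- by move: fx; rewrite e map_f.
- by move: fx; rewrite -e map_f.
Qed.

Lemma card_set_seq (T : choiceType) (s : seq T) :
  uniq s -> ([set` s] #= `I_(size s))%card.
Proof.
move=> us; have <- : [set` [fset x in s]%fset] = [set` s].
  by apply/seteqP; split=> x; rewrite /= inE.
by apply/card_eq_fsetP; rewrite card_fseq undup_id.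
Qed.

Theorem mainTheorem2 (R : realType) :
  let c := chebyshev_center (@H3_domain R) in
  (orbit3 (@H3 R) c #= `I_120)%card /\
  optimal_sphere_approximation (orbit3 (@H3 R) c).
Proof.
move=> c; have [[a [a0 cE]] c45 hcap hfar] := chebyshev_center_H3 R.
rewrite -/c in cE c45 hcap hfar.
have hfin : finite_set (@H3 R) by rewrite H3_list; apply: finite_seq.
have free w w' : word_mx R w *m c = word_mx R w' *m c -> word_mx R w = word_mx R w'.
  move=> h; have : word_mx R (rev w' ++ w) = 1%:M.
    apply: (@interior_free R _ (a 0%N) (a 1%N) (a 2%N)); rewrite ?a0 // -cE.
    by rewrite word_mx_cat -mulmxA h mulmxA word_mx_rev mul1mx.
  rewrite word_mx_cat => /(congr1 (mulmx (word_mx R w'))).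
  by rewrite mulmxA (mulmx1C (word_mx_rev R w')) mul1mx mulmx1.
split.
  have -> : orbit3 (@H3 R) c = [set` [seq word_mx R w *m c | w <- h3_words]].
    rewrite /orbit3 H3_list; apply/seteqP; split=> [_ [k /mapP[w hw ->] <-]|x /mapP[w hw ->]].
      by apply/mapP; exists w.
    by exists (word_mx R w) => //; apply/mapP; exists w.
  have <- : size [seq word_mx R w *m c | w <- h3_words] = 120%N by rewrite size_map.
  apply: card_set_seq.
  rewrite map_inj_in_uniq; first exact: map_uniq h3_codes_uniq.
  move=> w w' hw hw' /free/word_mx_code.
  exact: (uniq_map_inj_in h3_codes_uniq).
have ha : orbit3 (@H3 R) c c by exists 1%:M; rewrite ?mul1mx //; have [] := H3_subgroup R.
split; first by exists (@H3 R), c; split=> //; exact: H3_subgroup.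
set r := Num.sqrt (1 - dot c c).
have c1 : dot c c <= 1.
  have /hcap : H3_domain (corner R 0) by split; [exact: corner_cone|apply/unit_sphereP/corner_unit].
  by have := dot_ge0 (corner R 0 - c); lra.
have r2 : r ^+ 2 = 1 - dot c c by rewrite sqr_sqrtr // subr_ge0.
have hX : hausdorff_dist (orbit3 (@H3 R) c) (@unit_sphere R) <= r.
  apply: hausdorff_dist_le.
  - by exists c.
  - by exists (corner R 0); apply/unit_sphereP/corner_unit.
  - rewrite H3E => _ [_ [w _ <-] <-].
    have e0 : 0 < enorm c by rewrite sqrtr_gt0; lra.
    exists ((enorm c)^-1 *: (word_mx R w *m c)).
      apply/unit_sphereP; rewrite scalemxAr dot_O3; last exact: word_mx_O3.
      by apply: unit_normalize; rewrite -dot_eq0 gt_eqF //; lra.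
    rewrite -{1}[word_mx R w *m c]scale1r -scalerBl ler_wsqrtr // dotZl dotZr.
    rewrite dot_O3 -?enorm_sqr; last exact: word_mx_O3.
    move: c1; rewrite -enorm_sqr; move: (enorm c) e0 => e e0 e1.
    have -> : (1 - e^-1) * ((1 - e^-1) * e ^+ 2) = (e - 1) ^+ 2 by field; rewrite gt_eqF.
    by nra.
  - move=> b /unit_sphereP hb; have [w hw] := chamber_exists b.
    have hwO := @word_mx_O3 R w.
    exists (word_mx R (rev w) *m c).
      by exists (word_mx R (rev w)) => //; rewrite H3E; exists (rev w).
    rewrite /enorm ler_wsqrtr // -(dot_O3 _ _ hwO) mulmxBr mulmxA.
    rewrite (mulmx1C (word_mx_rev R w)) mul1mx; apply: hcap; split=> //.
    by apply/unit_sphereP; rewrite dot_O3.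
move=> Y [K [x [hK Kfin ->]]]; rewrite leNgt; apply/negP => hlt.
have := hausdorff_dist_covers hK (lt_le_trans hlt hX); rewrite r2 => hcov.
have hcov5 : covers K x 5^-1.
  by move=> b /hcov[k Kk hk]; exists k => //; apply: lt_trans hk _; lra.
have [[e he hl]|[e [f [he hf hef]]]|hs] := finite_O3_classification hK Kfin.
- exact: (invariant_line_no_cover hK he hl hcov5).
- exact: (far_orbits_no_cover hK he hf hef hcov5).
- exact: (standard_no_cover hK hs hfar hcov).
Qed.
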